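(* Fix $n\ge1$ and $b>0$. Suppose that $|\langle\theta^\star,X_t\rangle|\le b$ for all $t\in\{1,\dots,n\}$, that $\psi$ is $M$-smooth on $\mathbb{R}$ and $m$-strongly convex on $[-b,b]$ with $m>0$, and let $\kappa=M/m$. Let $\mathcal{S}_{n,b}=\{\theta\in\mathbb{R}^d:\max_{1\le t\le n}|\langle\theta,X_t\rangle|\le b\}$, let $\widehat\theta_{n,b}=\arg\min_{\theta\in\mathcal{S}_{n,b}}\sum_{t=1}^n\ell_t(\theta)$, define $\Psi(\theta)=\sum_{t=1}^n\psi(\langle X_t,\theta\rangle)$ for $\theta\in\mathbb{R}^d$, and let $\mathcal{B}_\Psi$ be the associated Bregman divergence. Then, for any $\delta>0$, the set $$\Theta_n=\Big\{\theta\in\mathbb{R}^d:\ \mathcal{B}_\Psi\big(\theta,\widehat\theta_{n,b}\big)\le d\log(1+2\kappa)+2\log\frac1\delta\Big\}$$ satisfies $\mathbb{P}[\theta^\star\notin\Theta_n]\le\delta$.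
   Context: Generalized linear model (GLM) with obliviously chosen covariates and fixed sample size. Fix $d\ge1$. Labels take values in a measurable set $\mathcal{Y}\subseteq\mathbb{R}$ equipped with a fixed $\sigma$-finite reference measure $\mathrm{d}y$ (e.g. Lebesgue or counting measure); all densities on $\mathcal{Y}$ are with respect to it. Let $h:\mathcal{Y}\to[0,\infty)$ and let $\psi:\mathbb{R}\to\mathbb{R}$ be convex and differentiable, such that for all $x,\theta\in\mathbb{R}^d$ the function $p(y|x,\theta)=\exp(\langle\theta,x\rangle y-\psi(\langle\theta,x\rangle))h(y)$ is a probability density on $\mathcal{Y}$. The covariates $X_1,\dots,X_n\in\mathbb{R}^d$ are chosen independently of the realized labels (fixed design, i.i.d., or any joint distribution not influenced by the labels): conditionally on $(X_1,\dots,X_n)$, the labels $Y_1,\dots,Y_n$ are independent and $Y_t$ has density $p(\cdot|X_t,\theta^\star)$, where $\theta^\star\in\mathbb{R}^d$ is a fixed unknown parameter. It is assumed that $\Lambda_n=\sum_{t=1}^nX_tX_t^\top$ has full rank $d$. Loss: $\ell_t(\theta)=-\langle\theta,X_t\rangle Y_t+\psi(\langle\theta,X_t\rangle)-\log h(Y_t)=-\log p(Y_t|X_t,\theta)$. $\psi$ is $M$-smooth on $\mathbb{R}$ if it is twice differentiable with $\psi''(z)\le M$ for all $z\in\mathbb{R}$, and $m$-strongly convex on $[-b,b]$ if $\psi''(z)\ge m$ for all $z\in[-b,b]$. For a convex differentiable $f:\mathbb{R}^d\to\mathbb{R}$, the Bregman divergence is $\mathcal{B}_f(\theta,\theta')=f(\theta)-f(\theta')-\langle\theta-\theta',\nabla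 f(\theta')\rangle$. *)

(* Defs.v *)
From mathcomp Require Export all_boot all_order all_algebra.
From mathcomp Require Export all_classical all_reals all_analysis.

Set Implicit Arguments.
Unset Strict Implicit.
Unset Printing Implicit Defensive.

Export Order.TTheory GRing.Theory Num.Theory.
Export numFieldNormedType.Exports.

Local Open Scope classical_set_scope.
Local Open Scope ring_scope.

(* Vectors of R^d are row vectors, so x x^T becomes [x^T *m x]. *)
Definition inner (R : realType) (d : nat) (u v : 'rV[R]_d) : R :=
  \sum_(i < d) u 0 i * v 0 i.

Definition gradient (R : realType) (d : nat) (f : 'rV[R]_d -> R)
    (x : 'rV[R]_d) : 'rV[R]_d :=
  \row_(i < d) 'D_(delta_mx 0 i) f x.

Definition bregman (R : realType) (d : nat) (f : 'rV[R]_d -> R)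
    (x y : 'rV[R]_d) : R :=
  f x - f y - inner (x - y) (gradient f y).

Definition is_argmin (T : Type) (R : realType) (S : set T) (f : T -> R)
    (x : T) : Prop :=
  S x /\ forall y, S y -> f x <= f y.

Definition smooth (R : realType) (psi : R -> R) (M : R) : Prop :=
  forall z, [/\ derivable psi z 1, derivable psi^`()%classic z 1 & (psi^`(2))%classic z <= M].

Definition strongly_convex_on (R : realType) (psi : R -> R) (b m : R) : Prop :=
  forall z, z \in `[- b, b] -> m <= (psi^`(2))%classic z.

(* Densities on the label set [D] with respect to [nu]. A reference measure on
   [D] is represented by a measure on R of which only the restriction to [D]
   is used; likewise only the values on [D] of a density matter. *)
Definition is_prob_density (R : realType)
    (nu : {sigma_finite_measure set (measurableTypeR R) -> \bar R}) (D : set R)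
    (f : R -> R) : Prop :=
  [/\ measurable_fun (D : set (measurableTypeR R)) f,
      forall y, D y -> 0 <= f y
    & (\int[nu]_(y in D) (f y)%:E = 1)%E].

Definition glm_density (R : realType) (d : nat) (psi h : R -> R)
    (x theta : 'rV[R]_d) (y : R) : R :=
  expR (inner theta x * y - psi (inner theta x)) * h y.

(* Since [ln 0 = 0], the loss is finite even where [h y = 0]; such labels have
   probability zero under the model. *)
Definition glm_loss (R : realType) (d : nat) (psi h : R -> R)
    (x : 'rV[R]_d) (y : R) (theta : 'rV[R]_d) : R :=
  - inner theta x * y + psi (inner theta x) - ln (h y).

Definition random_vector (R : realType) (d : nat) (disp : measure_display)
    (T : measurableType disp) (X : T -> 'rV[R]_d) : Prop :=
  forall i : 'I_d, measurable_fun [set: T] (fun w => X w 0 i).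

Definition sigma_covariates (R : realType) (d n : nat) (T : Type)
    (X : 'I_n -> T -> 'rV[R]_d) : set (set T) :=
  <<s [set E | exists (t : 'I_n) (i : 'I_d),
        exists2 B : set (measurableTypeR R),
          measurable B & E = [set w | B (X t w 0 i)]] >>.

(* Conditionally on (X_1, ..., X_n), the labels are independent and Y_t has
   density p(. | X_t, theta): for all Borel sets B_1, ..., B_n, the product of
   the integrals of p(. | X_t, theta) over the B_t is a version of the
   conditional probability of {Y_1 in B_1, ..., Y_n in B_n} given
   sigma(X_1, ..., X_n). In particular Y_t belongs to [D] almost surely. The
   joint law of the covariates is unconstrained. *)
Definition glm_model (R : realType) (d n : nat) (disp : measure_display)
    (T : measurableType disp) (P : probability T R)
    (nu : {sigma_finite_measure set (measurableTypeR R) -> \bar R}) (D : set R)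
    (psi h : R -> R) (theta : 'rV[R]_d)
    (X : 'I_n -> T -> 'rV[R]_d) (Y : 'I_n -> T -> R) : Prop :=
  forall (E : set T) (B : 'I_n -> set (measurableTypeR R)),
    sigma_covariates X E -> (forall t, measurable (B t)) ->
    (P (E `&` [set w | forall t, B t (Y t w)]) =
     \int[P]_(w in E) \prod_(t < n)
       \int[nu]_(y in D `&` B t) (glm_density psi h (X t w) theta y)%:E)%E.

Definition design_gram (R : realType) (d n : nat) (x : 'I_n -> 'rV[R]_d) :
    'M[R]_d :=
  \sum_(t < n) (x t)^T *m x t.

Definition bounded_params (R : realType) (d n : nat) (b : R)
    (x : 'I_n -> 'rV[R]_d) : set 'rV[R]_d :=
  [set theta | forall t, `|inner theta (x t)| <= b].

Definition design_potential (R : realType) (d n : nat) (psi : R -> R)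
    (x : 'I_n -> 'rV[R]_d) (theta : 'rV[R]_d) : R :=
  \sum_(t < n) psi (inner (x t) theta).

Definition confidence_set (R : realType) (d n : nat) (psi : R -> R)
    (kappa delta : R) (x : 'I_n -> 'rV[R]_d) (c : 'rV[R]_d) :
    set 'rV[R]_d :=
  [set theta | bregman (design_potential psi x) theta c
                 <= d%:R * ln (1 + 2 * kappa) + 2 * ln (1 / delta)].

(* Main.v *)
Require Import Defs.
From mathcomp Require Import measurable_realfun ring lra.
Set Implicit Arguments.
Unset Strict Implicit.
Unset Printing Implicit Defensive.
Local Open Scope classical_set_scope.
Local Open Scope ring_scope.

(* Let [e] and [s] be the linear predictors [<theta_star, X_t>] and
   [<theta_hat, X_t>], and [Lambda] the Gram matrix of the design. Given the
   covariates, average the likelihood ratio [p(Y | theta) / p(Y | theta_star)]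
   over [theta] drawn from the Gaussian law centred at [theta_star] with
   covariance [(c Lambda)^-1], where [c = m / 2]. This evidence has mean at
   most 1, so by Markov's inequality it exceeds [1 / delta] with probability at
   most [delta]. The centre may be the unknown [theta_star], because the prior
   occurs only in the analysis.

   Expanding [psi] to second order at [s], with [psi'' <= M] and the first-order
   optimality of [theta_hat], bounds the evidence from below by
     exp(B - c / 2 * sum_t (e_t - s_t)^2) * (1 + M / c)^(- d / 2),
   where [B] is the Bregman divergence. Strong convexity gives
   [m / 2 * sum_t (e_t - s_t)^2 <= B], hence the evidence is at least
   exp(B / 2) * (1 + 2 M / m)^(- d / 2), which exceeds [1 / delta] as soon as
   [theta_star] is outside the confidence set.

   The prior is sampled as [theta_star + A z / sqrt c] with [z] standard normal
   and [A^T Lambda A = 1]; [A] is an inverse Cholesky factor, so that it is a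
   measurable function of the covariates. *)

(** * Nonnegative linear functionals *)

Section nonneg_functionals.
Local Open Scope ereal_scope.
Import HBNNSimple.

(** Here [v] may be infinite. The product of extended reals is discontinuous only where [0] meets an
    infinity, so two cases are treated apart: [limn f = 0], where monotonicity forces every term to
    vanish, and [v = 0]. *)
Lemma ge0_muleZ_lim (R : realType) (v : \bar R) (f : (\bar R)^nat) :
  0 <= v -> (forall k, 0 <= f k) -> nondecreasing_seq f ->
  limn (fun k => v * f k) = v * limn f.
Proof.
move=> v0 f0 ndf.
have cf : f @ \oo --> limn f by exact: ereal_nondecreasing_is_cvgn.
apply/cvg_lim => //.
have [lf0|lf0] := eqVneq (limn f) 0.
  have fE k : f k = 0.
    apply/eqP; rewrite eq_le f0 andbT -lf0.
    apply: lime_ge; first exact: ereal_nondecreasing_is_cvgn.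
    by exists k => // j /= kj; apply: ndf.
  rewrite lf0 mule0; under eq_fun do rewrite fE mule0.
  exact: cvg_cst.
have [->|v_neq0] := eqVneq v 0.
  by under eq_fun do rewrite mul0e; rewrite mul0e; exact: cvg_cst.
apply: (cvgeM _ (cvg_cst v) cf).
by rewrite mule_defE (negPf v_neq0) (negPf lf0).
Qed.

(* Both sides of the law of the labels given the covariates have these
   properties in each test function, so an identity between them extends from
   indicators to all nonnegative measurable functions. *)
Definition ge0_linear_functional (d : measure_display) (S : measurableType d)
    (R : realType) (F : (S -> \bar R) -> \bar R) : Prop :=
  [/\ forall f g : S -> \bar R, measurable_fun setT f -> measurable_fun setT g ->
        (forall x, 0 <= f x) -> (forall x, 0 <= g x) ->
        F (f \+ g) = F f + F g,
      forall (r : R) (f : S -> \bar R), (0 <= r)%R -> measurable_fun setT f ->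
        (forall x, 0 <= f x) -> F (fun x => r%:E * f x) = r%:E * F f
    & forall f_ : (S -> \bar R)^nat, (forall k, measurable_fun setT (f_ k)) ->
        (forall k x, 0 <= f_ k x) ->
        (forall x, nondecreasing_seq (f_ ^~ x)) ->
        F (fun x => limn (f_ ^~ x)) = limn (fun k => F (f_ k))].

(** Additivity and homogeneity carry the identity from indicators to nonnegative simple functions;
    the limit property then applies to an increasing simple approximation of [f]. *)
Lemma ge0_linear_functional_eq (d : measure_display) (S : measurableType d)
    (R : realType) (F G : (S -> \bar R) -> \bar R) :
  ge0_linear_functional F -> ge0_linear_functional G ->
  (forall A, measurable A ->
     F (fun x => (\1_A x)%:E) = G (fun x => (\1_A x)%:E)) ->
  forall f : S -> \bar R,
    measurable_fun setT f -> (forall x, 0 <= f x) -> F f = G f.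
Proof.
move=> [FD FZ Flim] [GD GZ Glim] FG f mf f0.
have FG0 : F (cst 0) = G (cst 0).
  have -> : cst 0 = (fun x : S => (\1_set0 x)%:E :> \bar R).
    by apply/funext => x; rewrite indic0.
  exact: FG.
have mterm (h : {nnsfun S >-> R}) r :
    measurable_fun setT (fun x => r%:E * (\1_(h @^-1` [set r]) x)%:E).
  by apply: measurable_funeM; apply/measurable_EFinP; exact: measurable_indic.
have term0 (h : {nnsfun S >-> R}) r x :
    0 <= r%:E * (\1_(h @^-1` [set r]) x)%:E.
  have [r0|r0] := leP 0%R r; first by rewrite mule_ge0// lee_fin.
  by rewrite preimage_nnfun0// indic0 mule0.
have FGterm (h : {nnsfun S >-> R}) r :
    F (fun x => r%:E * (\1_(h @^-1` [set r]) x)%:E) =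
    G (fun x => r%:E * (\1_(h @^-1` [set r]) x)%:E).
  have mE : measurable_fun setT
      (fun x => (\1_(h @^-1` [set r]) x)%:E : \bar R).
    by apply/measurable_EFinP; exact: measurable_indic.
  (* Homogeneity covers nonnegative scalars only. This is enough, because a negative value of [r]
     has empty preimage under [h] and its term is zero. *)
  have [r0|r0] := leP 0%R r.
    by rewrite FZ// ?GZ// ?FG// => x; rewrite lee_fin.
  suff -> : (fun x => r%:E * (\1_(h @^-1` [set r]) x)%:E) = cst 0 by [].
  by apply/funext => x; rewrite preimage_nnfun0// indic0 mule0.
have FGsimple (h : {nnsfun S >-> R}) :
    F (fun x => (h x)%:E) = G (fun x => (h x)%:E).
  have -> : (fun x => (h x)%:E) =
      (fun x => \sum_(r <- finmap.enum_fset (fset_set (range h)))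
         r%:E * (\1_(h @^-1` [set r]) x)%:E).
    apply/funext => x; rewrite fimfunE fsbig_finite//= -sumEFin.
    by apply: eq_bigr => r _; rewrite EFinM.
  elim: (finmap.enum_fset _) => [|r s IH].
    suff -> : (fun x => \sum_(i <- [::]) i%:E * (\1_(h @^-1` [set i]) x)%:E) =
      cst 0 by [].
    by apply/funext => x; rewrite big_nil.
  have -> : (fun x => \sum_(i <- r :: s) i%:E * (\1_(h @^-1` [set i]) x)%:E) =
     (fun x => r%:E * (\1_(h @^-1` [set r]) x)%:E) \+
     (fun x => \sum_(i <- s) i%:E * (\1_(h @^-1` [set i]) x)%:E).
    by apply/funext => x; rewrite big_cons.
  have ms : measurable_fun setT
      (fun x => \sum_(i <- s) i%:E * (\1_(h @^-1` [set i]) x)%:E).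
    by apply: emeasurable_sum.
  have s0 x : 0 <= \sum_(i <- s) i%:E * (\1_(h @^-1` [set i]) x)%:E.
    by apply: sume_ge0.
  by rewrite FD// GD// IH FGterm.
pose f_ := nnsfun_approx measurableT mf.
have -> : f = (fun x => limn (fun k => (f_ k x)%:E)).
  by apply/funext => x; apply/esym/cvg_lim => //; exact: cvg_nnsfun_approx.
have mf_ k : measurable_fun setT (fun x => (f_ k x)%:E : \bar R).
  by exact/measurable_EFinP.
have nd_f x : nondecreasing_seq (fun k => (f_ k x)%:E).
  by move=> i j ij; rewrite lee_fin; exact/lefP/nd_nnsfun_approx.
rewrite (Flim (fun k x => (f_ k x)%:E))// ?(Glim (fun k x => (f_ k x)%:E))//.
- by congr (limn _); apply/funext => k.
- by move=> k x; rewrite lee_fin.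
- by move=> k x; rewrite lee_fin.
Qed.

(** The label side of the law: [phi] is one label and [u] gathers the factors of the others. It also
    serves with [phi] an identity map, for weights depending on the covariates or for integrals
    against a density. *)
Lemma ge0_linear_functional_comp (d1 d2 : measure_display)
    (T : measurableType d1) (S : measurableType d2) (R : realType)
    (P : {measure set T -> \bar R}) (E : set T) (phi : T -> S)
    (u : T -> \bar R) :
  measurable E -> measurable_fun setT phi -> measurable_fun setT u ->
  (forall w, 0 <= u w) ->
  ge0_linear_functional (fun f : S -> \bar R => \int[P]_(w in E) (u w * f (phi w))).
Proof.
move=> mE mphi mu u0; split.
- move=> f g mf mg f0 g0.
  rewrite -ge0_integralD//.
  + by apply: eq_integral => w _; rewrite ge0_muleDr.
  + by move=> w _; rewrite mule_ge0.
  + by apply/measurable_funTS/emeasurable_funM => //; exact: measurableT_comp.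
  + by move=> w _; rewrite mule_ge0.
  + by apply/measurable_funTS/emeasurable_funM => //; exact: measurableT_comp.
- move=> r f r0 mf f0; rewrite -ge0_integralZl_EFin//.
  + by apply: eq_integral => w _; rewrite muleCA.
  + by move=> w _; rewrite mule_ge0.
  + by apply/measurable_funTS/emeasurable_funM => //; exact: measurableT_comp.
- move=> f_ mf f0 ndf; rewrite -monotone_convergence//.
  + by apply: eq_integral => w _; rewrite ge0_muleZ_lim.
  + move=> k.
    by apply/measurable_funTS/emeasurable_funM => //; exact: measurableT_comp.
  + by move=> k w _; rewrite mule_ge0.
  + by move=> w _ i j ij; apply: lee_pmul => //; exact: ndf.
Qed.

(** The model side of the law: [p] is the conditional density of one label and [v] gathers the
    factors of the others. Tonelli gives measurability of the inner integral, and monotone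
    convergence is used twice, for the inner and the outer integral. *)
Lemma ge0_linear_functional_kernel (d1 d2 : measure_display)
    (T : measurableType d1) (S : measurableType d2) (R : realType)
    (P : {measure set T -> \bar R})
    (nu : {sigma_finite_measure set S -> \bar R}) (E : set T)
    (p : T * S -> \bar R) (v : T -> \bar R) :
  measurable E -> measurable_fun setT p -> (forall z, 0 <= p z) ->
  measurable_fun setT v -> (forall w, 0 <= v w) ->
  ge0_linear_functional (fun f : S -> \bar R =>
    \int[P]_(w in E) (v w * \int[nu]_y (f y * p (w, y)))).
Proof.
move=> mE mp p0 mv v0.
have mpw w : measurable_fun setT (fun y => p (w, y)) by exact: measurableT_comp.
have mfp (f : S -> \bar R) w : measurable_fun setT f ->
    measurable_fun setT (fun y => f y * p (w, y)).
  by move=> mf; exact: emeasurable_funM.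
have mI (f : S -> \bar R) : measurable_fun setT f -> (forall y, 0 <= f y) ->
    measurable_fun E (fun w => v w * \int[nu]_y (f y * p (w, y))).
  move=> mf f0; apply/measurable_funTS/emeasurable_funM => //.
  apply: (@measurable_fun_fubini_tonelli_F _ _ _ _ _ nu
    (fun z => f z.2 * p z)) => [|z]; last by rewrite mule_ge0.
  by apply: emeasurable_funM => //; exact: measurableT_comp.
have I0 (f : S -> \bar R) w : (forall y, 0 <= f y) ->
    0 <= \int[nu]_y (f y * p (w, y)).
  by move=> f0; apply: integral_ge0 => y _; rewrite mule_ge0.
split.
- move=> f g mf mg f0 g0.
  rewrite -ge0_integralD//; [|by move=> w _; rewrite mule_ge0 ?I0|exact: mI|
    by move=> w _; rewrite mule_ge0 ?I0|exact: mI].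
  apply: eq_integral => w _; rewrite -ge0_muleDr ?I0//; congr (_ * _).
  rewrite -ge0_integralD//; [|by move=> y _; rewrite mule_ge0|exact: mfp|
    by move=> y _; rewrite mule_ge0|exact: mfp].
  by apply: eq_integral => y _; rewrite ge0_muleDl.
- move=> r f r0 mf f0; rewrite -ge0_integralZl_EFin//; [|
    by move=> w _; rewrite mule_ge0 ?I0|exact: mI].
  apply: eq_integral => w _; rewrite [RHS]muleCA; congr (_ * _).
  rewrite -ge0_integralZl_EFin//; [|by move=> y _; rewrite mule_ge0|exact: mfp].
  by apply: eq_integral => y _; rewrite muleA.
- move=> f_ mf f0 ndf; rewrite -monotone_convergence//.
  + apply: eq_integral => w _.
    rewrite ge0_muleZ_lim//; last 2 first.
    * by move=> k; rewrite I0.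
    * move=> i j ij; apply: ge0_le_integral => //.
      - by move=> y _; rewrite mule_ge0.
      - exact: mfp.
      - exact: mfp.
      - by move=> y _; rewrite lee_wpmul2r//; exact: ndf.
    congr (_ * _); rewrite -monotone_convergence//.
    * apply: eq_integral => y _; rewrite muleC -ge0_muleZ_lim//.
      by under eq_fun do rewrite muleC.
    * by move=> k; exact: mfp.
    * by move=> k y _; rewrite mule_ge0.
    * by move=> y _ i j ij; rewrite lee_wpmul2r//; exact: ndf.
  + by move=> k; exact: mI.
  + by move=> k w _; rewrite mule_ge0 ?I0.
  + move=> w _ i j ij; rewrite lee_wpmul2l//; apply: ge0_le_integral => //.
    * by move=> y _; rewrite mule_ge0.
    * exact: mfp.
    * exact: mfp.
    * by move=> y _; rewrite lee_wpmul2r//; exact: ndf.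
Qed.

End nonneg_functionals.

(** * Integrating out conditionally independent labels *)

Section product_formula.
Local Open Scope ereal_scope.

(** Indicators are exchanged for general functions one coordinate at a time. The induction is on a
    bound [k] such that all coordinates of index at least [k] are still indicators. *)
Lemma ge0_family_ind (n : nat) (d : measure_display) (S : measurableType d)
    (R : realType) (Q : ('I_n -> S -> \bar R) -> Prop) :
  (forall B : 'I_n -> set S, (forall t, measurable (B t)) ->
     Q (fun t x => (\1_(B t) x)%:E)) ->
  (forall t (g : 'I_n -> S -> \bar R),
     (forall s, measurable_fun setT (g s)) -> (forall s x, 0 <= g s x) ->
     (forall A : set S, measurable A ->
        Q (fun s x => if s == t then (\1_A x)%:E else g s x)) ->
     Q g) ->
  forall g : 'I_n -> S -> \bar R,
    (forall s, measurable_fun setT (g s)) -> (forall s x, 0 <= g s x) -> Q g.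
Proof.
move=> Qindic Qstep.
have H k (g : 'I_n -> S -> \bar R) : (forall s, measurable_fun setT (g s)) ->
    (forall s x, 0 <= g s x) ->
    (forall t : 'I_n, (k <= t)%N ->
       exists A : set S, measurable A /\ g t = (fun x => (\1_A x)%:E)) ->
    Q g.
  elim: k g => [|k IH] g mg g0 gE.
    have {}gE t := gE t isT.
    have [B BE] := choice gE.
    have -> : g = (fun t x => (\1_(B t) x)%:E).
      by apply/funext => t; have [] := BE t.
    by apply: Qindic => t; have [] := BE t.
  have [kn|nk] := ltnP k n; last first.
    by apply: IH => // t kt; have := ltn_ord t; rewrite ltnNge (leq_trans nk kt).
  apply: (Qstep (Ordinal kn)) => // A mA; apply: IH => [s|s x|t kt].
  - have [_|_] := eqVneq s (Ordinal kn); last exact: mg.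
    by apply/measurable_EFinP; exact: measurable_indic.
  - by case: ifP => // _; rewrite lee_fin.
  - have [_|tk] := eqVneq t (Ordinal kn); first by exists A.
    apply: gE; rewrite ltn_neqAle kt andbT.
    by apply: contra tk => /eqP tk; apply/eqP/val_inj.
by move=> g mg g0; apply: (H n) => // t; rewrite leqNgt ltn_ord.
Qed.

Lemma emeasurable_prod (d : measure_display) (T : measurableType d)
    (R : realType) (I : Type) (r : seq I) (Q : pred I) (f : I -> T -> \bar R) :
  (forall i, measurable_fun setT (f i)) ->
  measurable_fun setT (fun w => \prod_(i <- r | Q i) f i w).
Proof.
move=> mf; elim: r => [|i r IH].
  by under eq_fun do rewrite big_nil; exact: measurable_cst.
under eq_fun do rewrite big_cons.
by case: (Q i) => //; exact: emeasurable_funM.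
Qed.

Context (d : measure_display) (T : measurableType d) (R : realType)
  (P : probability T R)
  (nu : {sigma_finite_measure set (measurableTypeR R) -> \bar R})
  (G : set (set T)) (n : nat)
  (Y : 'I_n -> T -> measurableTypeR R)
  (p : 'I_n -> g_sigma_algebraType G * measurableTypeR R -> \bar R).
Hypotheses (Gm : <<s G>> `<=` @measurable d T)
  (mY : forall t, measurable_fun setT (Y t))
  (mp : forall t, measurable_fun setT (p t))
  (p0 : forall t z, 0 <= p t z)
  (law : forall (E : set T) (B : 'I_n -> set (measurableTypeR R)),
    <<s G>> E -> (forall t, measurable (B t)) ->
    P (E `&` [set w | forall t, B t (Y t w)]) =
    \int[P]_(w in E) \prod_(t < n) \int[nu]_y ((\1_(B t) y)%:E * p t (w, y))).

(** The identity, viewed as a map to the coarser measurable space generated by [G]; composing with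
    it turns measurability for [<<s G>>] into measurability on [T]. *)
Let idG : T -> g_sigma_algebraType G := fun w => w.

Let measurable_idG : measurable_fun setT idG.
Proof. by move=> _ A mA; rewrite setTI; exact: Gm. Qed.

Let p' t (z : T * measurableTypeR R) := p t (idG z.1, z.2).

Let mp' t : measurable_fun setT (p' t).
Proof.
apply: (measurableT_comp (mp t)).
apply/measurable_fun_pairP; split.
  exact: (measurableT_comp measurable_idG measurable_fst).
exact: measurable_snd.
Qed.

Let measurable_inner_integral (g : measurableTypeR R -> \bar R) t :
  measurable_fun setT g -> (forall y, 0 <= g y) ->
  measurable_fun setT (fun w : T => \int[nu]_y (g y * p t (w, y))).
Proof.
move=> mg g0.
apply: (@measurable_fun_fubini_tonelli_F _ _ _ _ _ nu
  (fun z : T * measurableTypeR R => g z.2 * p' t z)) => [|z].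
  by apply: emeasurable_funM => //; exact: measurableT_comp.
by rewrite mule_ge0//; exact: p0.
Qed.

Let inner_integral_ge0 (g : measurableTypeR R -> \bar R) t (w : T) :
  (forall y, 0 <= g y) -> 0 <= \int[nu]_y (g y * p t (w, y)).
Proof. by move=> g0; apply: integral_ge0 => y _; rewrite mule_ge0. Qed.

(** [law] is the case of indicators. With all coordinates but [t] fixed, both sides are nonnegative
    linear functionals of [g t], so agreement on indicators in that coordinate is sufficient. *)
Lemma integral_setI_prod_labels (E : set T)
    (g : 'I_n -> measurableTypeR R -> \bar R) :
  <<s G>> E -> (forall t, measurable_fun setT (g t)) ->
  (forall t y, 0 <= g t y) ->
  \int[P]_(w in E) \prod_(t < n) g t (Y t w) =
  \int[P]_(w in E) \prod_(t < n) \int[nu]_y (g t y * p t (w, y)).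
Proof.
move=> GE; have mE := Gm GE; move: g; apply: ge0_family_ind => [B mB|t g mg g0 gA].
  rewrite -law//; set C := [set w | _].
  have mC : measurable C.
    have -> : C = \bigcap_(t in [set: 'I_n]) (Y t @^-1` B t).
      by apply/seteqP; split => [w wB t _|w wB t]; exact: wB.
    apply: fin_bigcap_measurable => // t _; rewrite -[X in measurable X]setTI.
    exact: mY.
  rewrite setIC -integral_indic//; apply: eq_integral => w _.
  have [wC|] := pselect (C w).
    rewrite indicE mem_set// big1// => t _.
    by rewrite indicE mem_set//; exact: wC.
  move=> /[dup] wC /existsNP[t wt].
  by rewrite (bigD1 t)//= !indicE !memNset ?mul0e.
pose u (w : T) := \prod_(s < n | s != t) g s (Y s w).
pose v (w : T) := \prod_(s < n | s != t) \int[nu]_y (g s y * p s (w, y)).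
have mu_ : measurable_fun setT u.
  by apply: emeasurable_prod => s; exact: (measurableT_comp (mg s)).
have mv : measurable_fun setT v.
  by apply: emeasurable_prod => s; exact: measurable_inner_integral.
have u0 w : 0 <= u w by apply: prode_ge0.
have v0 w : 0 <= v w by apply: prode_ge0 => s _; exact: inner_integral_ge0.
transitivity (\int[P]_(w in E) (u w * g t (Y t w))).
  by apply: eq_integral => w _; rewrite (bigD1 t)//= muleC.
transitivity (\int[P]_(w in E) (v w * \int[nu]_y (g t y * p t (w, y)))); last first.
  by apply: eq_integral => w _; rewrite (bigD1 t)//= muleC.
apply: (ge0_linear_functional_eq (ge0_linear_functional_comp P mE (mY t) mu_ u0)
  (ge0_linear_functional_kernel P nu mE (mp' t) (fun z => p0 _ _) mv v0)) => //.
move=> A mA; have := gA A mA.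
rewrite (_ : (fun _ => _) = fun w => u w * (\1_A (Y t w))%:E); last first.
  apply/funext => w; rewrite (bigD1 t)//= eqxx muleC; congr (_ * _).
  by apply: eq_bigr => s /negPf ->.
move=> ->; apply: eq_integral => w _; rewrite (bigD1 t)//= eqxx muleC.
by congr (_ * _); apply: eq_bigr => s /negPf ->.
Qed.

(** Both sides are nonnegative linear functionals of the weight [c], and they agree on indicators of
    events of [<<s G>>] by the previous lemma. *)
Lemma integral_prod_labels (c : g_sigma_algebraType G -> \bar R)
    (g : 'I_n -> measurableTypeR R -> \bar R) :
  measurable_fun setT c -> (forall w, 0 <= c w) ->
  (forall t, measurable_fun setT (g t)) -> (forall t y, 0 <= g t y) ->
  \int[P]_w (c w * \prod_(t < n) g t (Y t w)) =
  \int[P]_w (c w * \prod_(t < n) \int[nu]_y (g t y * p t (w, y))).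
Proof.
move=> mc c0 mg g0.
pose u (w : T) := \prod_(t < n) g t (Y t w).
pose v (w : T) := \prod_(t < n) \int[nu]_y (g t y * p t (w, y)).
have mu_ : measurable_fun setT u.
  by apply: emeasurable_prod => s; exact: (measurableT_comp (mg s)).
have mv : measurable_fun setT v.
  by apply: emeasurable_prod => s; exact: measurable_inner_integral.
have u0 w : 0 <= u w by apply: prode_ge0.
have v0 w : 0 <= v w by apply: prode_ge0 => s _; exact: inner_integral_ge0.
transitivity (\int[P]_w (u w * c (idG w))).
  by apply: eq_integral => w _; rewrite muleC.
transitivity (\int[P]_w (v w * c (idG w))); last first.
  by apply: eq_integral => w _; rewrite muleC.
apply: (ge0_linear_functional_eq
  (ge0_linear_functional_comp P measurableT measurable_idG mu_ u0)
  (ge0_linear_functional_comp P measurableT measurable_idG mv v0)) => //.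
move=> A mA; have := integral_setI_prod_labels mA mg g0.
by rewrite !(integral_mkcond (A : set T)) !epatch_indic.
Qed.

End product_formula.

(** * Likelihood ratios *)

Lemma measurable_fun_sub_sigma (d d' : measure_display) (T : measurableType d)
    (S : measurableType d') (G : set (set T)) (f : T -> S) :
  <<s G>> `<=` @measurable d T ->
  measurable_fun [set: g_sigma_algebraType G] f -> measurable_fun [set: T] f.
Proof.
move=> Gm mf _ B mB; apply: Gm.
by have := mf measurableT B mB.
Qed.

(** The approximation lies below [x] by at most [1 / (k + 1)]. It discretizes parameters that depend
    on the covariates. *)
Lemma cvg_floor_approx (R : realType) (x : R) :
  (Num.floor (k.+1%:R * x))%:~R / k.+1%:R @[k --> \oo] --> x.
Proof.
apply/cvgrPdist_le => eps eps0; near=> k.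
have k0 : 0 < k.+1%:R :> R by rewrite ltr0n.
rewrite ler_norml; apply/andP; split.
  rewrite (@le_trans _ _ 0) ?oppr_le0 ?(ltW eps0)// subr_ge0 ler_pdivrMr//.
  by rewrite mulrC floor_le.
rewrite (@le_trans _ _ k.+1%:R^-1)//; last first.
  by near: k; have := near_infty_natSinv_lt (PosNum eps0); apply: filterS => k /ltW.
rewrite lerBlDr -[X in X + _]mul1r -mulrDl ler_pdivlMr// mulrC ltW//.
by rewrite addrC -[1 in X in _ < X]/(1%:~R) -intrD floorD1_gt.
Unshelve. all: end_near. Qed.

Lemma measurable_mulr_cst (R : realType) (r : R) :
  measurable_fun [set: measurableTypeR R] (fun y : measurableTypeR R => r * y : R).
Proof.
have h : measurable_fun [set: measurableTypeR R]
    (fun y : measurableTypeR R => y : R).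
  exact: measurable_id.
by apply: (measurable_funM _ h); exact: measurable_cst.
Qed.

Section likelihood_ratio.
Local Open Scope ereal_scope.
Context (d : measure_display) (T : measurableType d) (R : realType)
  (P : probability T R)
  (nu : {sigma_finite_measure set (measurableTypeR R) -> \bar R})
  (G : set (set T)) (n : nat)
  (Y : 'I_n -> T -> measurableTypeR R)
  (psi hD : measurableTypeR R -> R)
  (e : 'I_n -> g_sigma_algebraType G -> R).

Let p t (z : g_sigma_algebraType G * measurableTypeR R) : \bar R :=
  (expR (e t z.1 * z.2 - psi (e t z.1)) * hD z.2)%:E.

Hypotheses (Gm : <<s G>> `<=` @measurable d T)
  (mY : forall t, measurable_fun setT (Y t))
  (me : forall t, measurable_fun setT (e t))
  (psi_cont : continuous (psi : R -> R))
  (mhD : measurable_fun setT hD)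
  (hD0 : forall y, (0 <= hD y)%R)
  (normalized : forall r : R,
    \int[nu]_y (expR (r * y - psi r) * hD y)%:E = 1)
  (law : forall (E : set T) (B : 'I_n -> set (measurableTypeR R)),
    <<s G>> E -> (forall t, measurable (B t)) ->
    P (E `&` [set w | forall t, B t (Y t w)]) =
    \int[P]_(w in E) \prod_(t < n) \int[nu]_y ((\1_(B t) y)%:E * p t (w, y))).

Let mpsi : measurable_fun [set: R] (psi : R -> R).
Proof. exact: continuous_measurable_fun. Qed.

Let mp t : measurable_fun setT (p t).
Proof.
apply/measurable_EFinP; apply: measurable_funM; last exact: measurableT_comp.
apply: measurableT_comp => //; apply: measurable_funB.
  apply: measurable_funM => //; first exact: measurableT_comp.
by apply: (measurableT_comp mpsi); exact: measurableT_comp.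
Qed.

Let p0 t z : 0 <= p t z.
Proof. by rewrite lee_fin mulr_ge0 ?expR_ge0. Qed.

(** The ratio of the joint densities of the labels at natural parameters [e t + a t] and [e t], in
    which the factors [hD] have cancelled. *)
Definition likelihood_ratio (a : 'I_n -> T -> R) (w : T) : R :=
  \prod_(t < n) expR (a t w * Y t w - (psi (e t w + a t w) - psi (e t w))).

Lemma likelihood_ratio_ge0 a w : (0 <= likelihood_ratio a w)%R.
Proof. by apply: prodr_ge0 => t _; exact: expR_ge0. Qed.

Lemma measurable_likelihood_ratio (a : 'I_n -> T -> R) :
  (forall t, measurable_fun setT (a t)) ->
  measurable_fun setT (likelihood_ratio a).
Proof.
move=> ma; apply: measurable_prod => t _.
have met : measurable_fun [set: T] (e t) by exact: (measurable_fun_sub_sigma Gm).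
apply: measurableT_comp => //; apply: measurable_funB.
  apply: measurable_funM; [exact: ma|exact: mY].
apply: measurable_funB; last exact: (measurableT_comp mpsi).
by apply: (measurableT_comp mpsi); exact: measurable_funD.
Qed.

(** Conditionally on the covariates, [expR (alpha t * Y t)] has mean [expR (D t)], by normalization
    at the parameter [e t + alpha t]; this cancels the factor [expR (- D t)]. Localizing to events
    [E] of the covariates makes it possible to glue pieces with different constants. *)
Let integral_likelihood_ratio_cst (alpha : 'I_n -> R) (E : set T) :
  <<s G>> E ->
  \int[P]_(w in E) (likelihood_ratio (fun t _ => alpha t) w)%:E = P E.
Proof.
move=> GE; have mE := Gm GE.
pose D t (w : g_sigma_algebraType G) : R := (psi (e t w + alpha t) - psi (e t w))%R.
have mD t : measurable_fun setT (D t).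
  apply: measurable_funB; last exact: (measurableT_comp mpsi).
  by apply: (measurableT_comp mpsi); exact: measurable_funD.
pose c (w : g_sigma_algebraType G) : \bar R :=
  (\1_E w)%:E * \prod_(t < n) (expR (- D t w))%:E.
have mc : measurable_fun setT c.
  apply: emeasurable_funM.
    by apply/measurable_EFinP; exact: measurable_indic.
  apply: emeasurable_prod => t; apply/measurable_EFinP.
  by apply: measurableT_comp => //; exact: measurableT_comp.
have c0 w : 0 <= c w.
  by rewrite mule_ge0 ?lee_fin//; apply: prode_ge0 => t _; rewrite lee_fin expR_ge0.
pose g t (y : measurableTypeR R) : \bar R := (expR (alpha t * y))%:E.
have mg t : measurable_fun setT (g t).
  apply/measurable_EFinP.
  exact: (measurableT_comp (@measurable_expR R) (measurable_mulr_cst _)).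
have g0 t y : 0 <= g t y by rewrite lee_fin expR_ge0.
have gE t w : \int[nu]_y (g t y * p t (w, y)) = (expR (D t w))%:E.
  transitivity (\int[nu]_y ((expR (D t w))%:E *
      (expR ((e t w + alpha t) * y - psi (e t w + alpha t)%R) * hD y)%:E)).
    apply: eq_integral => y _; rewrite -!EFinM !mulrA -!expRD /= /D.
    by congr (expR _ * _)%:E; ring.
  rewrite ge0_integralZl_EFin ?normalized ?mule1 ?expR_ge0//.
    by move=> y _; rewrite lee_fin mulr_ge0 ?expR_ge0.
  apply/measurable_EFinP; apply: measurable_funM => //.
  apply: measurableT_comp => //.
  exact: (measurable_funB (measurable_mulr_cst _) (measurable_cst _)).
have := integral_prod_labels Gm mY mp p0 law mc c0 mg g0.
under [in RHS]eq_integral => w _.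
  rewrite (eq_bigr _ (fun t _ => gE t w)) /c -muleA -big_split/=.
  rewrite big1 => [|t _]; last by rewrite -EFinM -expRD addNr expR0.
  rewrite mule1; over.
rewrite integral_indic// setIT => <-.
rewrite integral_mkcond epatch_indic; apply: eq_integral => w _.
rewrite muleC /c -muleA -big_split/=; congr (_ * _).
rewrite /likelihood_ratio -prodEFin; apply: eq_bigr => t _.
by rewrite -EFinM -expRD; congr (expR _)%:E; rewrite /D addrC.
Qed.

(** The level sets of [kappa], numbered by [pickle], form a countable partition into covariate
    events. The parameters are constant on each piece, which therefore contributes its own
    probability. *)
Let integral_likelihood_ratio_countable (K : countType) (kappa : T -> K)
    (alpha : K -> 'I_n -> R) :
  (forall k, <<s G>> [set w | kappa w = k]) ->
  measurable_fun setT (likelihood_ratio (fun t w => alpha (kappa w) t)) /\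
  \int[P]_w (likelihood_ratio (fun t w => alpha (kappa w) t) w)%:E = 1.
Proof.
move=> Gkappa.
pose F j := [set w | choice.pickle (kappa w) = j].
have GF j : <<s G>> (F j).
  have [[k kj]|nk] := pselect (exists k : K, choice.pickle k = j).
    rewrite (_ : F j = [set w | kappa w = k])//.
    apply/seteqP; split => w; last by rewrite /F /= => ->.
    by rewrite /F /= -kj => /(pcan_inj choice.pickleK).
  rewrite (_ : F j = set0); first exact: sigma_algebra0.
  by apply/seteqP; split => w //= wj; apply: nk; exists (kappa w).
have mF j : measurable (F j) by exact: Gm.
have FT : \bigcup_j F j = setT.
  by apply/seteqP; split => w // _; exists (choice.pickle (kappa w)).
have tF : trivIset setT F.
  by move=> i j _ _ [w [/= <- <-]].
have LF j w0 : F j w0 -> {in F j, forall w,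
   likelihood_ratio (fun t w => alpha (kappa w) t) w =
   likelihood_ratio (fun t _ => alpha (kappa w0) t) w}.
  move=> /= Fj w; rewrite inE /F/= -Fj => /(pcan_inj choice.pickleK) kw.
  by rewrite /likelihood_ratio /= kw.
have mL : measurable_fun setT (likelihood_ratio (fun t w => alpha (kappa w) t)).
  rewrite -FT; apply/measurable_fun_bigcup => // j.
  have [[w0 Fw0]|Fj0] := pselect (F j !=set0); last first.
    rewrite (_ : F j = set0); first exact: measurable_fun_set0.
    by apply/seteqP; split => // w Fw; apply: Fj0; exists w.
  apply: (eq_measurable_fun (likelihood_ratio (fun t _ => alpha (kappa w0) t))).
    by move=> w wF; rewrite (LF j w0).
  by apply: measurable_funTS; apply: measurable_likelihood_ratio.
split => //.
rewrite -FT ge0_integral_bigcup//; last 2 first.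
- by rewrite FT; exact/measurable_EFinP.
- by move=> w _; rewrite lee_fin likelihood_ratio_ge0.
transitivity (\sum_(j <oo) P (F j)).
  apply: eq_eseriesr => j _.
  have [[w0 Fw0]|Fj0] := pselect (F j !=set0); last first.
    rewrite (_ : F j = set0) ?integral_set0 ?measure0//.
    by apply/seteqP; split => // w Fw; apply: Fj0; exists w.
  rewrite -(integral_likelihood_ratio_cst (alpha (kappa w0)) (GF j)).
  by apply: eq_integral => w wF; rewrite (LF j w0).
rewrite -measure_semi_bigcup//; last exact: bigcup_measurable.
by rewrite FT; exact: probability_setT.
Qed.

(* For constant [a] this is the normalization of the density with natural
   parameter [e t + a t]; a general [a] is the limit of the countably valued
   [floor((k + 1) a) / (k + 1)], and the bound passes to the limit by Fatou's
   lemma. *)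
Lemma integral_likelihood_ratio_le1 (a : 'I_n -> T -> R) :
  (forall t, measurable_fun [set: g_sigma_algebraType G] (a t)) ->
  \int[P]_w (likelihood_ratio a w)%:E <= 1.
Proof.
move=> ma.
pose kappa k w : {ffun 'I_n -> int} :=
  [ffun t => Num.floor (k.+1%:R * a t w)%R].
pose alpha k (z : {ffun 'I_n -> int}) t : R := ((z t)%:~R / k.+1%:R)%R.
pose L k := likelihood_ratio (fun t w => alpha k (kappa k w) t).
have [mL intL] : (forall k, measurable_fun setT (L k)) /\
    forall k, \int[P]_w (L k w)%:E = 1.
  suff H k : measurable_fun setT (L k) /\ \int[P]_w (L k w)%:E = 1.
    by split => k; have [] := H k.
  apply: integral_likelihood_ratio_countable => z.
  (* A prescribed integer part means membership in a half-open unit interval, so the level sets of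
     [kappa k] are covariate events. *)
  rewrite (_ : [set w | _] = \bigcap_(t in [set: 'I_n])
     ((fun w => k.+1%:R * a t w)%R @^-1` `[(z t)%:~R, (z t + 1)%:~R[)).
    apply: (@fin_bigcap_measurable _ (g_sigma_algebraType G)) => // t _.
    rewrite -[X in measurable X]setTI.
    have : measurable_fun [set: g_sigma_algebraType G]
      (fun w => k.+1%:R * a t w)%R by exact: measurable_funM.
    by apply => //; exact: measurable_itv.
  apply/seteqP; split => [w /= <- t _|w /= wz].
    by rewrite /= ffunE in_itv/= floor_itv.
  apply/ffunP => t; rewrite ffunE; apply/eqP; rewrite floor_eq.
  by have := wz t Logic.I; rewrite /= in_itv/=.
have cvgL w : (L k w)%:E @[k --> \oo] --> (likelihood_ratio a w)%:E.
  apply/cvg_EFin; first exact: nearW.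
  apply: cvg_big => [|t _]; first exact: mul_continuous.
  have cva : alpha k (kappa k w) t @[k --> \oo] --> a t w.
    by under eq_fun do rewrite /alpha ffunE; exact: cvg_floor_approx.
  apply: continuous_cvg; first exact: continuous_expR.
  apply: cvgB; first by apply: cvgMl; exact: cva.
  apply: cvgB; last exact: cvg_cst.
  apply: (@continuous_cvg _ R R _ _ _ psi); first exact: psi_cont.
  by apply: cvgD; [exact: cvg_cst|exact: cva].
have -> : \int[P]_w (likelihood_ratio a w)%:E =
    \int[P]_w limn_einf (fun k => (L k w)%:E).
  by apply: eq_integral => w _; rewrite (cvg_limn_einf_sup (cvgL w)).1.
apply: (le_trans (fatou P measurableT _ _)).
- by move=> k; exact/measurable_EFinP.
- by move=> k w _; rewrite lee_fin likelihood_ratio_ge0.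
under eq_fun do rewrite intL.
by rewrite (cvg_limn_einf_sup (cvg_cst 1)).1.
Qed.

End likelihood_ratio.

(** * Gaussian integrals *)

Section gaussian.
Local Open Scope ereal_scope.

(** Only the product formula for integrals is used later, so the sample space can stay abstract. It
    is built by taking the product with one more copy of [N] at each step and applying Tonelli; for
    [k = 0] any probability space serves, and [N] itself is taken. *)
Lemma iid_sample_space (R : realType) (N : probability (measurableTypeR R) R)
    (k : nat) :
  exists (disp : measure_display) (Z : measurableType disp)
         (Q : probability Z R) (z : 'I_k -> Z -> measurableTypeR R),
    (forall i, measurable_fun setT (z i)) /\
    forall g : 'I_k -> measurableTypeR R -> \bar R,
      (forall i, measurable_fun setT (g i)) -> (forall i x, 0 <= g i x) ->
      \int[Q]_w \prod_(i < k) g i (z i w) = \prod_(i < k) \int[N]_x g i x.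
Proof.
elim: k => [|k [disp [Z [Q [z [mz IH]]]]]].
  exists _, _, N, (fun _ => id); split => [[]//|g mg g0].
  rewrite big_ord0; under eq_integral do rewrite big_ord0.
  by rewrite integral_cst// mul1e; exact: probability_setT.
pose z' (i : 'I_k.+1) (w : measurableTypeR R * Z) : measurableTypeR R :=
  if unlift ord0 i is Some j then z j w.2 else w.1.
exists _, _, (N \x Q), z'; split => [i|g mg g0].
  rewrite /z'; case: (unlift ord0 i) => [j|]; last exact: measurable_fst.
  exact: (measurableT_comp (mz j) measurable_snd).
have mrest : measurable_fun setT (fun w => \prod_(i < k) g (lift ord0 i) (z i w)).
  by apply: emeasurable_prod => i; exact: (measurableT_comp (mg _) (mz i)).
have rest0 w : 0 <= \prod_(i < k) g (lift ord0 i) (z i w) by apply: prode_ge0.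
transitivity (\int[N \x Q]_w (g ord0 w.1 *
    \prod_(i < k) g (lift ord0 i) (z i w.2))).
  apply: eq_integral => w _; rewrite big_ord_recl /z' unlift_none.
  by congr (_ * _); apply: eq_bigr => i _; rewrite liftK.
rewrite fubini_tonelli1; last 2 first.
- apply: emeasurable_funM.
    exact: (measurableT_comp (mg ord0) measurable_fst).
  exact: (measurableT_comp mrest measurable_snd).
- by move=> w; rewrite mule_ge0.
rewrite /fubini_F /= big_ord_recl -IH// -ge0_integralZr//; last first.
  by apply: integral_ge0.
by apply: eq_integral => x _; rewrite ge0_integralZl.
Qed.

(** On indicators this is the definition of [normal_prob]; the functional principle extends it to
    nonnegative functions. *)
Lemma integral_normal_prob (R : realType) (m s : R)
    (f : measurableTypeR R -> \bar R) :
  measurable_fun setT f -> (forall x, 0 <= f x) ->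
  \int[normal_prob m s]_x f x =
  \int[lebesgue_measure]_x ((normal_pdf m s x)%:E * f x).
Proof.
move=> mf f0.
transitivity (\int[normal_prob m s]_x (1 * f x)).
  by apply: eq_integral => x _; rewrite mul1e.
have mid : measurable_fun [set: measurableTypeR R] id by exact: measurable_id.
have mpdf : measurable_fun [set: measurableTypeR R]
    (fun x : measurableTypeR R => (normal_pdf m s x)%:E).
  by apply/measurable_EFinP; exact: measurable_normal_pdf.
apply: (ge0_linear_functional_eq
  (ge0_linear_functional_comp (normal_prob m s) measurableT mid
    (measurable_cst 1) (fun _ => lee01))
  (ge0_linear_functional_comp (@lebesgue_measure R) measurableT mid mpdf _)) => //.
  by move=> x; rewrite lee_fin normal_pdf_ge0.
move=> A mA; transitivity (normal_prob m s A).
  under eq_integral do rewrite mul1e.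
  by rewrite integral_indic// setIT.
by rewrite /normal_prob (integral_mkcond A) epatch_indic.
Qed.

Lemma measurable_expR_quadratic (R : realType) (v a c : R) :
  measurable_fun [set: measurableTypeR R] (fun x : measurableTypeR R =>
    expR (- (v * (x - c)) - a * (x - c) ^+ 2) : R)%R.
Proof.
apply: measurableT_comp => //.
have mxc : measurable_fun [set: measurableTypeR R]
    (fun x : measurableTypeR R => x - c : R)%R.
  by apply: measurable_funB; [exact: measurable_id|exact: measurable_cst].
apply: measurable_funB; last first.
  by apply: measurable_funM; [exact: measurable_cst|exact: measurable_funX].
apply: measurableT_comp => //.
by apply: measurable_funM => //; exact: measurable_cst.
Qed.

(* The factor [exp(k^2 (1 + a) / 2) >= 1] produced by completing the square is
   dropped. *)
Lemma gaussian_quadratic_lower_bound (R : realType) (a v c : R) :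
  (0 <= a)%R ->
  (expR (- (c ^+ 2 / 2)) / Num.sqrt (1 + a))%:E <=
  \int[normal_prob 0 1]_(x in [set: measurableTypeR R])
     (expR (- (v * (x - c)) - a / 2 * (x - c) ^+ 2))%:E.
Proof.
move=> a0; have a1 : (0 < 1 + a)%R by lra.
have s0 : (0 < Num.sqrt (1 + a))%R by rewrite sqrtr_gt0.
(* Standard deviation and mean of the Gaussian found by completing the square in
   [- x^2 / 2 - v (x - c) - a / 2 (x - c)^2]. *)
pose s : R := ((Num.sqrt (1 + a))^-1)%R.
pose mean : R := (c - (v + c) / (1 + a))%R.
have s_neq0 : s != 0%R by rewrite invr_neq0// gt_eqF.
have mQ := measurable_expR_quadratic v (a / 2) c.
rewrite integral_normal_prob; last 2 first.
- exact/measurable_EFinP.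
- by move=> x; rewrite lee_fin expR_ge0.
rewrite -[leLHS]mule1 -(integral_normal_pdf mean s).
rewrite -ge0_integralZl_EFin//; last 2 first.
- by move=> x _; rewrite lee_fin normal_pdf_ge0.
- by apply/measurable_EFinP; exact: measurable_normal_pdf.
apply: ge0_le_integral => //.
- move=> x _; rewrite lee_fin; apply: mulr_ge0; last exact: normal_pdf_ge0.
  by rewrite divr_ge0 ?expR_ge0// ltW.
- apply: measurable_funeM; apply/measurable_EFinP; exact: measurable_normal_pdf.
- apply: emeasurable_funM; apply/measurable_EFinP => //.
  exact: measurable_normal_pdf.
move=> x _; rewrite lee_fin !normal_pdfE ?oner_neq0//.
rewrite /normal_fun /normal_peak.
have s2 : (s ^+ 2 = (1 + a)^-1)%R by rewrite /s exprVn sqr_sqrtr// ltW.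
have a1' := ltW a1.
rewrite (_ : s ^+ 2 * pi *+ 2 = (1 + a)^-1 * (pi *+ 2))%R; last first.
  by rewrite s2 -mulrnAr.
rewrite s2 expr1n mul1r sqrtrM ?invr_ge0// sqrtrV// invfM invrK -/s.
set peak := (Num.sqrt (pi *+ 2))^-1%R.
have peak0 : (0 <= peak)%R by rewrite invr_ge0 sqrtr_ge0.
rewrite [leLHS](_ : _ = peak * (expR (- (c ^+ 2 / 2)) *
    expR (- (x - mean) ^+ 2 / ((1 + a)^-1 *+ 2))))%R; last first.
  set q := Num.sqrt (1 + a); set E1 := expR _; set E2 := expR _.
  by rewrite /s -/q; field; rewrite gt_eqF.
rewrite -[leRHS]mulrA ler_wpM2l// -!expRD ler_expR.
rewrite /mean; set k := ((v + c) / (1 + a))%R.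
(* Expressing [v] through [k] makes the difference of the two exponents exactly the square that is
   dropped. *)
have -> : v = (k * (1 + a) - c)%R by rewrite /k divfK ?gt_eqF// addrK.
rewrite -subr_ge0.
rewrite [leRHS](_ : (_ = (1 + a) / 2 * k ^+ 2)%R); last by field; rewrite gt_eqF.
by rewrite mulr_ge0 ?sqr_ge0// divr_ge0.
Qed.

End gaussian.

(** * Measurable inverse Cholesky factors *)

Section measurable_matrices.
Context (disp : measure_display) (T : measurableType disp) (R : realType).

Definition measurable_mx (p q : nat) (S : T -> 'M[R]_(p, q)) : Prop :=
  forall i j, measurable_fun [set: T] (fun w => S w i j).

Lemma measurable_mx_mul p q r (A : T -> 'M[R]_(p, q)) (B : T -> 'M[R]_(q, r)) :
  measurable_mx A -> measurable_mx B -> measurable_mx (fun w => A w *m B w).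
Proof.
move=> mA mB i j; under eq_fun do rewrite mxE.
by apply: measurable_sum => k; apply: measurable_funM; [exact: mA|exact: mB].
Qed.

Lemma measurable_mx_tr p q (A : T -> 'M[R]_(p, q)) :
  measurable_mx A -> measurable_mx (fun w => (A w)^T).
Proof. by move=> mA i j; under eq_fun do rewrite mxE; exact: mA. Qed.

Lemma measurable_mx_scale p q (a : T -> R) (A : T -> 'M[R]_(p, q)) :
  measurable_fun setT a -> measurable_mx A -> measurable_mx (fun w => a w *: A w).
Proof.
move=> ma mA i j; under eq_fun do rewrite mxE.
by apply: measurable_funM; [|exact: mA].
Qed.

Lemma measurable_mx_sub p q (A B : T -> 'M[R]_(p, q)) :
  measurable_mx A -> measurable_mx B -> measurable_mx (fun w => A w - B w).
Proof.
move=> mA mB i j; under eq_fun do rewrite !mxE.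
by apply: measurable_funB; [exact: mA|exact: mB].
Qed.

Lemma measurable_mx_sum (I : Type) (r : seq I) p q (A : I -> T -> 'M[R]_(p, q)) :
  (forall i, measurable_mx (A i)) -> measurable_mx (fun w => \sum_(i <- r) A i w).
Proof.
move=> mA i j; under eq_fun do rewrite summxE.
by apply: measurable_sum => k; exact: mA.
Qed.

Lemma measurable_mx_scalar p (a : T -> R) :
  measurable_fun setT a -> measurable_mx (fun w => (a w)%:M : 'M[R]_p).
Proof.
move=> ma i j; under eq_fun do rewrite mxE.
by case: (i == j) => //=; under eq_fun do rewrite mulr0n; exact: measurable_cst.
Qed.

Lemma measurable_block_mx p1 p2 q1 q2 (A : T -> 'M[R]_(p1, q1))
    (B : T -> 'M[R]_(p1, q2)) (C : T -> 'M[R]_(p2, q1)) (D : T -> 'M[R]_(p2, q2)) :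
  measurable_mx A -> measurable_mx B -> measurable_mx C -> measurable_mx D ->
  measurable_mx (fun w => block_mx (A w) (B w) (C w) (D w)).
Proof.
move=> mA mB mC mD i j; under eq_fun do rewrite mxE.
case: (fintype.split i) => k; under eq_fun do rewrite mxE;
  case: (fintype.split j) => l.
- exact: mA.
- exact: mB.
- exact: mC.
- exact: mD.
Qed.

End measurable_matrices.

Definition posdefmx (R : realType) (k : nat) (S : 'M[R]_k) : Prop :=
  S^T = S /\ forall v : 'rV[R]_k, v != 0 -> 0 < (v *m S *m v^T) 0 0.

(** The vector [(1, 0)] shows [0 < s]. For [u != 0], the vector [(- al, u)] with [al = s^-1 u r^T]
    annihilates the first block, so the form of the block matrix at it equals the form of the Schur
    complement at [u]. *)
Lemma posdefmx_schur (R : realType) (k : nat) (s : R) (r : 'rV[R]_k)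
    (S : 'M[R]_k) :
  posdefmx (block_mx s%:M r r^T S) ->
  0 < s /\ posdefmx (S - s^-1 *: (r^T *m r)).
Proof.
move=> [Ssym Spos].
have s0 : 0 < s.
  have := Spos (row_mx 1%:M 0).
  rewrite mul_row_block !mul0mx !addr0 !mul1mx tr_row_mx mul_row_col trmx0 mulmx0.
  rewrite addr0 tr_scalar_mx mulmx1 mxE eqxx mulr1n; apply.
  apply/negP => /eqP/matrixP/(_ 0 (lshift _ 0)).
  by rewrite row_mxEl !mxE eqxx => /eqP; rewrite oner_eq0.
split => //.
have S'sym : S^T = S.
  by move: Ssym; rewrite tr_block_mx => /eq_block_mx[].
split => [|u u0].
  by rewrite linearB linearZ/= trmx_mul trmxK S'sym.
pose al := s^-1 *: (u *m r^T).
have := Spos (row_mx (- al) u).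
rewrite mul_row_block tr_row_mx mul_row_col.
have ->: - al *m s%:M + u *m r^T = 0.
  by rewrite mul_mx_scalar scalerN scalerA divff ?gt_eqF// scale1r addNr.
rewrite mul0mx add0r.
have -> : - al *m r + u *m S = u *m (S - s^-1 *: (r^T *m r)).
  by rewrite mulmxBr -scalemxAr mulmxA mulNmx -scalemxAl addrC.
apply; apply: contra u0 => /eqP/matrixP uE.
apply/eqP/matrixP => i j.
by have := uE i (rshift 1 j); rewrite row_mxEr !mxE.
Qed.

(** Recursion on the dimension through the Schur complement. The formula is total and uses only ring
    operations and a real power of entries, hence preserves measurability; positive definiteness
    matters only for the identity. *)
Lemma measurable_inverse_cholesky (R : realType) (k : nat) :
  exists chol : 'M[R]_k -> 'M[R]_k,
    (forall (disp : measure_display) (T : measurableType disp)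
       (S : T -> 'M[R]_k),
       measurable_mx S -> measurable_mx (fun w => chol (S w))) /\
    (forall S : 'M[R]_k, posdefmx S -> (chol S)^T *m S *m chol S = 1%:M).
Proof.
elim: k => [|k [chol [mchol cholE]]].
  exists id; split => // S _; by apply/matrixP => -[].
rewrite -[k.+1]/(1 + k)%N.
pose s (S : 'M[R]_(1 + k)) : R := ulsubmx S 0 0.
pose q (S : 'M[R]_(1 + k)) := s S `^ (- 2^-1).
pose S1 (S : 'M[R]_(1 + k)) :=
  chol (drsubmx S - (q S ^+ 2) *: ((ursubmx S)^T *m ursubmx S)).
(* Upper triangular factor: [q] is the inverse square root of the corner entry, [S1] the inverse
   factor of the Schur complement, and the off-diagonal block is chosen to cancel the cross
   terms. *)
exists (fun S : 'M[R]_(1 + k) =>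
  block_mx (q S)%:M (- (q S ^+ 2) *: (ursubmx S *m S1 S)) 0 (S1 S)).
split => [disp T S mS|S Spos].
  have mq : measurable_fun setT (fun w => q (S w)).
    apply: (measurableT_comp (measurable_powR _)).
    by rewrite /s; under eq_fun do rewrite !mxE; exact: mS.
  have mur : measurable_mx (fun w => @ursubmx _ 1 k 1 k (S w)).
    by move=> i j; under eq_fun do rewrite !mxE; exact: mS.
  have mdr : measurable_mx (fun w => @drsubmx _ 1 k 1 k (S w)).
    by move=> i j; under eq_fun do rewrite !mxE; exact: mS.
  have mS1 : measurable_mx (fun w => S1 (S w)).
    apply: mchol; apply: measurable_mx_sub => //.
    apply: measurable_mx_scale; first exact: measurable_funX.
    by apply: measurable_mx_mul => //; exact: measurable_mx_tr.
  apply: (@measurable_block_mx _ _ _ 1 k 1 k (fun w => (q (S w))%:M)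
    (fun w => - (q (S w) ^+ 2) *: (@ursubmx _ 1 k 1 k (S w) *m S1 (S w)))
    (fun=> 0)
    (fun w => S1 (S w))) => //.
  - exact: measurable_mx_scalar.
  - apply: measurable_mx_scale; last exact: measurable_mx_mul.
    by apply: measurableT_comp => //; exact: measurable_funX.
have SE : S = block_mx (s S)%:M (ursubmx S) (ursubmx S)^T (drsubmx S).
  rewrite -[LHS]submxK; congr block_mx; first exact: mx11_scalar.
  by rewrite trmx_ursub Spos.1.
have [s0 Dpos] : 0 < s S /\ posdefmx (drsubmx S - (s S)^-1 *:
    ((ursubmx S)^T *m ursubmx S)).
  by apply: posdefmx_schur; rewrite -SE.
have q2 : q S ^+ 2 = (s S)^-1.
  rewrite /q expr2 -powRD; last by rewrite (gt_eqF s0) implybT.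
  by rewrite (_ : - 2^-1 + - 2^-1 = -1 :> R) ?powR_inv1 ?ltW//; lra.
rewrite -q2 in Dpos; have := cholE _ Dpos; rewrite -/(S1 S).
set C := S1 S => CE.
set r := ursubmx S in SE CE *; set D := drsubmx S in SE CE *.
rewrite [X in _ *m X *m _]SE -mulmxA mulmx_block tr_block_mx mulmx_block.
rewrite !mulmx0 !addr0 trmx0 !mul0mx !addr0.
have -> : (s S)%:M *m (- q S ^+ 2 *: (r *m C)) + r *m C = 0.
  rewrite mul_scalar_mx scalerA mulrN q2 mulfV ?gt_eqF//.
  by rewrite scaleN1r addNr.
have -> : r^T *m (- q S ^+ 2 *: (r *m C)) + D *m C =
    (D - q S ^+ 2 *: (r^T *m r)) *m C.
  by rewrite mulmxBl -scalemxAr -scalemxAl mulmxA scaleNr addrC.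
rewrite !mulmx0 add0r [C^T *m (_ *m C)]mulmxA CE.
have -> : (- q S ^+ 2 *: (r *m C))^T *m ((s S)%:M *m (q S)%:M) +
    C^T *m (r^T *m (q S)%:M) = 0.
  rewrite linearZ/= trmx_mul -scalar_mxM !mul_mx_scalar -scalemxAr !scalerA.
  by rewrite -scalerDl q2 mulrN mulrAC mulfV ?gt_eqF// mul1r addNr scale0r.
rewrite tr_scalar_mx -!scalar_mxM mulrCA -expr2 q2 mulfV ?gt_eqF//.
by rewrite -scalar_mx_block.
Qed.

(** * Second-order expansions and Bregman divergences *)

Section taylor.
Context (R : realType).

Lemma mean_value (f df : R -> R) (s z : R) :
  (forall x : R, is_derive x 1 f (df x)) ->
  exists c, [/\ f z - f s = df c * (z - s), Num.min s z <= c & c <= Num.max s z].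
Proof.
move=> fE; have cf (i : interval R) : {within [set` i], continuous f}.
  by apply: derivable_within_continuous => x _; have := fE x.
have [sz|/ltW zs] := leP s z.
  have [c + ->] := MVT_segment sz (fun x _ => fE x) (cf _).
  by rewrite in_itv/= => /andP[? ?]; exists c.
have [c + E] := MVT_segment zs (fun x _ => fE x) (cf _).
rewrite in_itv/= => /andP[? ?]; exists c; split => //.
by rewrite -opprB E; ring.
Qed.

(** The mean value theorem is applied to [f] minus the quadratic, giving a point [c] between [s] and
    [z], and then to [f1] between [s] and [c]; the sign follows since [c - s] and [z - s] never have
    opposite signs. *)
Lemma taylor2_lower (f f1 f2 : R -> R) (K lo hi s z : R) :
  (forall x : R, is_derive x 1 f (f1 x)) ->
  (forall x : R, is_derive x 1 f1 (f2 x)) ->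
  (forall x, lo <= x <= hi -> K <= f2 x) ->
  lo <= s <= hi -> lo <= z <= hi ->
  f s + f1 s * (z - s) + K / 2 * (z - s) ^+ 2 <= f z.
Proof.
move=> fE f1E f2K /andP[los shi] /andP[loz zhi].
have dg (x : R) : is_derive x 1 (fun x => f x - f1 s * x - K / 2 * (x - s) ^+ 2)
    (f1 x - f1 s - K * (x - s)).
  have H := fE x.
  apply: is_derive_eq.
  by rewrite /GRing.scale/=; field.
have [c [gE c1 c2]] := mean_value s z dg.
have [d [fE' d1 d2]] := mean_value s c f1E.
have Kd : K <= f2 d.
  apply: f2K; move: c1 c2 d1 d2.
  have [?|?] := leP s z; have [?|?] := leP s c; lra.
suff : 0 <= (f1 c - f1 s - K * (c - s)) * (z - s) by rewrite -gE; nra.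
rewrite fE' -mulrBl -mulrA mulr_ge0 ?subr_ge0//.
by move: c1 c2; have [?|?] := leP s z => ? ?; nra.
Qed.

Lemma derive_affine_sum (n : nat) (psi : R -> R) (c s : 'I_n -> R) :
  (forall z, derivable psi z 1) ->
  is_derive (0 : R) 1 (fun h : R => \sum_(t < n) psi (h * c t + s t))
    (\sum_(t < n) psi^`()%classic (s t) * c t).
Proof.
move=> dpsi.
have -> : (fun h : R => \sum_(t < n) psi (h * c t + s t)) =
    \sum_(t < n) (fun h : R => psi (h * c t + s t)).
  by apply/funext => h; rewrite fct_sumE.
apply: is_derive_sum => t.
have H : is_derive (0 * c t + s t) 1 psi (psi^`()%classic (s t)).
  by rewrite mul0r add0r derive1E; exact: derivableP.
have H2 : is_derive (0 : R) 1 (fun h : R => h * c t + s t) (c t).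
  by apply: is_derive_eq; rewrite /GRing.scale/=; ring.
exact: (@is_derive1_comp R psi (fun h => h * c t + s t) 0 _ _ H H2).
Qed.

End taylor.

(** * Derivatives of the design potential and first-order optimality *)

Section bregman_glm.
Context (R : realType).

(** The lower expansion applied to [- f] on the interval between [s] and [z]. *)
Lemma taylor2_upper (f f1 f2 : R -> R) (M s z : R) :
  (forall x : R, is_derive x 1 f (f1 x)) ->
  (forall x : R, is_derive x 1 f1 (f2 x)) -> (forall x, f2 x <= M) ->
  f z <= f s + f1 s * (z - s) + M / 2 * (z - s) ^+ 2.
Proof.
move=> fE f1E f2M.
have nfE (x : R) : is_derive x 1 (- f) (- f1 x).
  by have ? := fE x; exact: is_deriveN.
have nf1E (x : R) : is_derive x 1 (- f1) (- f2 x).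
  by have ? := f1E x; exact: is_deriveN.
have nf2M x : Num.min s z <= x <= Num.max s z -> - M <= - f2 x by rewrite lerN2.
have := taylor2_lower nfE nf1E nf2M.
move=> /(_ s z); rewrite !fctE !ge_min !le_max !lexx !orbT /= => /(_ isT isT).
by nra.
Qed.

Lemma innerC (d : nat) (u v : 'rV[R]_d) : inner u v = inner v u.
Proof. by apply: eq_bigr => i _; rewrite mulrC. Qed.

Lemma innerDr (d : nat) (u v w : 'rV[R]_d) :
  inner u (v + w) = inner u v + inner u w.
Proof. by rewrite -big_split; apply: eq_bigr => i _; rewrite mxE mulrDr. Qed.

Lemma innerZr (d : nat) (a : R) (u v : 'rV[R]_d) :
  inner u (a *: v) = a * inner u v.
Proof. by rewrite mulr_sumr; apply: eq_bigr => i _; rewrite mxE mulrCA. Qed.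

Lemma innerBr (d : nat) (u v w : 'rV[R]_d) :
  inner u (v - w) = inner u v - inner u w.
Proof. by rewrite innerDr -scaleN1r innerZr mulN1r. Qed.

(** Along the line through [c] with direction [v] the potential is a function [phi] of one variable
    with the same difference quotients, which reduces the claim to the one-variable chain rule. *)
Lemma derive_design_potential (d n : nat) (psi : R -> R)
    (x : 'I_n -> 'rV[R]_d) (c v : 'rV[R]_d) :
  (forall z : R, derivable psi z 1) ->
  'D_v (design_potential psi x) c =
  \sum_(t < n) psi^`()%classic (inner (x t) c) * inner (x t) v.
Proof.
move=> dpsi.
pose phi (h : R) := \sum_(t < n) psi (h * inner (x t) v + inner (x t) c).
have phiE h : design_potential psi x (h *: v + c) = phi h.
  by apply: eq_bigr => t _; rewrite innerDr innerZr.
have : 'D_1 phi (0 : R) =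
    \sum_(t < n) psi^`()%classic (inner (x t) c) * inner (x t) v.
  by have [] := derive_affine_sum (fun t => inner (x t) v)
    (fun t => inner (x t) c) dpsi.
move=> <-; rewrite /derive.
suff -> : (fun h : R => h^-1 *: ((design_potential psi x \o shift c) (h *: v) -
      design_potential psi x c)) =
    (fun h : R => h^-1 *: ((phi \o shift (0 : R)) (h *: (1 : R)) - phi 0)) by [].
apply/funext => h /=.
by rewrite phiE -[in LHS](add0r c) -(scale0r v) phiE /GRing.scale/= mulr1 addr0.
Qed.

Lemma bregman_design_potential (d n : nat) (psi : R -> R)
    (x : 'I_n -> 'rV[R]_d) (theta c : 'rV[R]_d) :
  (forall z : R, derivable psi z 1) ->
  bregman (design_potential psi x) theta c =
  \sum_(t < n) (psi (inner (x t) theta) - psi (inner (x t) c) -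
    psi^`()%classic (inner (x t) c) * (inner (x t) theta - inner (x t) c)).
Proof.
move=> dpsi; rewrite /bregman sumrB sumrB; congr (_ - _).
have gradE i : gradient (design_potential psi x) c 0 i =
    \sum_(t < n) psi^`()%classic (inner (x t) c) * x t 0 i.
  rewrite mxE derive_design_potential//; apply: eq_bigr => t _; congr (_ * _).
  rewrite /inner (bigD1 i)//= big1 ?addr0 => [|j ji].
    by rewrite mxE !eqxx mulr1.
  by rewrite mxE (negPf ji) andbF mulr0.
transitivity (\sum_(i < d) \sum_(t < n)
    psi^`()%classic (inner (x t) c) * (x t 0 i * (theta - c) 0 i)).
  apply: eq_bigr => i _; rewrite gradE mulr_sumr; apply: eq_bigr => t _.
  by rewrite mulrC mulrA.
rewrite exchange_big/=; apply: eq_bigr => t _.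
by rewrite -innerBr mulr_sumr.
Qed.

(** Moving a fraction [l] from [s] towards [e] changes the loss by at most [l Q + l^2 C], by the
    upper expansion. Minimality makes this nonnegative on [[0, 1]], which is impossible for small
    [l] if [Q < 0]. *)
Lemma first_order_optimality (n : nat) (psi f1 f2 : R -> R) (M : R)
    (y e s : 'I_n -> R) :
  (forall x : R, is_derive x 1 psi (f1 x)) ->
  (forall x : R, is_derive x 1 f1 (f2 x)) ->
  (forall x, f2 x <= M) ->
  (forall l, 0 <= l <= 1 ->
    \sum_(t < n) (- s t * y t + psi (s t)) <=
    \sum_(t < n) (- (s t + l * (e t - s t)) * y t + psi (s t + l * (e t - s t)))) ->
  0 <= \sum_(t < n) (f1 (s t) - y t) * (e t - s t).
Proof.
move=> fE f1E f2M smin.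
set Q := (X in 0 <= X).
pose C := `|M / 2 * \sum_(t < n) (e t - s t) ^+ 2| + 1.
have C0 : 0 < C by rewrite ltr_wpDl.
have key l : 0 <= l <= 1 -> 0 <= l * Q + l ^+ 2 * C.
  move=> l01; have := smin l l01; rewrite -subr_ge0 -sumrB => /le_trans; apply.
  apply: (@le_trans _ _ (l * Q + l ^+ 2 * (M / 2 * \sum_(t < n) (e t - s t) ^+ 2))).
    rewrite /Q !mulr_sumr -big_split; apply: ler_sum => t _ /=.
    have := taylor2_upper (s t) (s t + l * (e t - s t)) fE f1E f2M.
    rewrite [_ + _ - s t]addrAC subrr add0r.
    by set p := psi (_ + _); nra.
  rewrite lerD2l ler_wpM2l ?sqr_ge0// /C.
  by rewrite (le_trans (ler_norm _))// lerDl.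
rewrite leNgt; apply/negP => Q0.
(* Half of the threshold [- Q / C], capped at 1, so that [Q + l C <= Q / 2 < 0]. The summand 1 in
   [C] keeps the denominator positive. *)
pose l := Num.min 1 (- Q / (2 * C)).
have l0 : 0 < l by rewrite lt_min ltr01/= divr_gt0// ?oppr_gt0// mulr_gt0.
have lC : l * C <= - Q / 2.
  rewrite (_ : - Q / 2 = - Q / (2 * C) * C); last by field; rewrite gt_eqF.
  by rewrite ler_wpM2r ?(ltW C0)// ge_min lexx orbT.
have := key l; rewrite (ltW l0) ge_min lexx/= => /(_ isT).
rewrite expr2 -mulrA -mulrDr pmulr_rge0//; lra.
Qed.

End bregman_glm.

(** * The evidence of the Gaussian prior *)

Section evidence.
Context (R : realType).

Lemma lee_prode (I : Type) (r : seq I) (f g : I -> \bar R) :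
  (forall i, 0 <= f i)%E -> (forall i, f i <= g i)%E ->
  (\prod_(i <- r) f i <= \prod_(i <- r) g i)%E.
Proof.
move=> f0 fg.
suff /andP[] : (0 <= \prod_(i <- r) f i)%E &&
  (\prod_(i <- r) f i <= \prod_(i <- r) g i)%E by [].
elim/big_ind2 : _ => [|x1 x2 y1 y2 /andP[? ?] /andP[? ?]|i _].
- by rewrite lexx lee01.
- by rewrite mule_ge0//= lee_pmul.
- by rewrite f0 fg.
Qed.

(** A matrix with orthonormal columns is an isometry; the squares are expanded and the sums
    exchanged. *)
Lemma sum_sqr_orthonormal (d n : nat) (xi : 'I_n -> 'I_d -> R) (r : 'I_d -> R) :
  (forall i j, \sum_(t < n) xi t i * xi t j = (i == j)%:R) ->
  \sum_(t < n) (\sum_(i < d) xi t i * r i) ^+ 2 = \sum_(i < d) r i ^+ 2.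
Proof.
move=> orth.
transitivity (\sum_(i < d) \sum_(j < d)
    (\sum_(t < n) xi t i * xi t j) * (r i * r j)).
  under [RHS]eq_bigr do under eq_bigr do rewrite mulr_suml.
  under [RHS]eq_bigr do rewrite exchange_big/=.
  rewrite [RHS]exchange_big/=; apply: eq_bigr => t _.
  rewrite expr2 mulr_suml; apply: eq_bigr => i _.
  by rewrite mulr_sumr; apply: eq_bigr => j _; rewrite mulrACA.
apply: eq_bigr => i _; rewrite (bigD1 i)//= [X in _ + X]big1 ?addr0 => [|j ji].
  by rewrite orth eqxx mul1r expr2.
by rewrite orth eq_sym (negPf ji) mul0r.
Qed.

Context (d n : nat) (disp : measure_display) (Z : measurableType disp)
  (Q : probability Z R) (z : 'I_d -> Z -> measurableTypeR R).
Hypotheses (mz : forall i, measurable_fun setT (z i))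
  (z_iid : forall g : 'I_d -> measurableTypeR R -> \bar R,
    (forall i, measurable_fun setT (g i)) -> (forall i x, (0 <= g i x)%E) ->
    (\int[Q]_w \prod_(i < d) g i (z i w) =
     \prod_(i < d) \int[normal_prob 0 1]_x g i x)%E).

(** [xi] is the whitened design and [dl] gives the coordinates of [s - e] in it, scaled by [sqrt c].
    In these coordinates the quadratic lower bound of the exponent separates, and the integral
    factors into one-dimensional Gaussian integrals. *)
Lemma evidence_lower_bound (psi f1 f2 : R -> R) (M c : R)
    (xi : 'I_n -> 'I_d -> R) (dl : 'I_d -> R) (e s y : 'I_n -> R)
    (a := fun t w => (Num.sqrt c)^-1 * \sum_(i < d) xi t i * z i w) :
  0 < c -> 0 <= M ->
  (forall x : R, is_derive x 1 psi (f1 x)) ->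
  (forall x : R, is_derive x 1 f1 (f2 x)) ->
  (forall x, f2 x <= M) ->
  (forall i j, \sum_(t < n) xi t i * xi t j = (i == j)%:R) ->
  (forall t, s t - e t = (Num.sqrt c)^-1 * \sum_(i < d) xi t i * dl i) ->
  0 <= \sum_(t < n) (f1 (s t) - y t) * (e t - s t) ->
  ((expR (\sum_(t < n) (psi (e t) - psi (s t) - f1 (s t) * (e t - s t))) *
    \prod_(i < d) (expR (- (dl i ^+ 2 / 2)) / Num.sqrt (1 + M / c)))%:E <=
  \int[Q]_w (\prod_(t < n)
    expR (a t w * y t - (psi (e t + a t w) - psi (e t))))%:E)%E.
Proof.
move=> c0 M0 psiE f1E f2M orth se opt.
set B := \sum_(t < n) (psi _ - _ - _).
pose g t := y t - f1 (s t).
pose v i := - (Num.sqrt c)^-1 * \sum_(t < n) g t * xi t i.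
pose G i (x : measurableTypeR R) : R :=
  expR (- (v i * (x - dl i)) - (M / c) / 2 * (x - dl i) ^+ 2).
have mG i : measurable_fun setT (G i).
  exact: measurable_expR_quadratic.
have mEG i : measurable_fun setT (fun x => (G i x)%:E).
  by apply/measurable_EFinP; exact: mG.
have G0 i x : (0 <= (G i x)%:E)%E by rewrite lee_fin expR_ge0.
(* After cancellation, the difference of the exponents is the gap in the upper expansion of [psi]
   from [s t] to [e t + a t w], summed over [t], plus the first-order term, nonnegative by [opt]. *)
have pointwise w : expR B * \prod_(i < d) G i (z i w) <=
    \prod_(t < n) expR (a t w * y t - (psi (e t + a t w) - psi (e t))).
  pose r i := (z i w : R) - dl i.
  have uE t : e t + a t w - s t = (Num.sqrt c)^-1 * \sum_(i < d) xi t i * r i.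
    rewrite (_ : e t + a t w - s t = a t w - (s t - e t)); last by ring.
    rewrite se -mulrBr -sumrB; congr (_ * _); apply: eq_bigr => i _.
    by rewrite mulrBr.
  have sq_u : \sum_(t < n) (e t + a t w - s t) ^+ 2 = c^-1 * \sum_(i < d) r i ^+ 2.
    under eq_bigr do rewrite uE exprMn exprVn sqr_sqrtr ?(ltW c0)//.
    rewrite -mulr_sumr; congr (_ * _).
    exact: sum_sqr_orthonormal.
  have lin_u : \sum_(t < n) g t * (e t + a t w - s t) = - \sum_(i < d) v i * r i.
    under eq_bigr do rewrite uE mulrCA mulr_sumr.
    rewrite -mulr_sumr exchange_big/= -sumrN mulr_sumr; apply: eq_bigr => i _.
    rewrite /v mulNr mulNr opprK -mulrA mulr_suml; congr (_ * _).
    by apply: eq_bigr => t _; rewrite mulrA.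
  rewrite -!(big_morph expR (@expRD R) (@expR0 R)) -expRD ler_expR.
  rewrite sumrB sumrN -lin_u -mulr_sumr -!/(r _).
  rewrite (_ : M / c / 2 * _ =
    M / 2 * \sum_(t < n) (e t + a t w - s t) ^+ 2); last first.
    by rewrite sq_u; field; rewrite gt_eqF.
  rewrite mulr_sumr -sumrB /B -big_split/=.
  rewrite -subr_ge0; apply: (le_trans opt); rewrite -sumrB.
  apply: ler_sum => t _.
  have := taylor2_upper (s t) (e t + a t w) psiE f1E f2M.
  by rewrite /g; set p := psi (_ + _); nra.
rewrite EFinM -prodEFin.
apply: (@le_trans _ _
  (\int[Q]_w (expR B * \prod_(i < d) G i (z i w))%:E)%E); last first.
  apply: ge0_le_integral => //.
  - move=> w _; rewrite lee_fin mulr_ge0 ?expR_ge0// prodr_ge0// => i _.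
    exact: expR_ge0.
  - apply/measurable_EFinP; apply: measurable_funM => //.
    apply: measurable_prod => i _; exact: (measurableT_comp (mG i) (mz i)).
  - have ma t : measurable_fun setT (a t : Z -> R).
      apply: measurable_funM; first exact: measurable_cst.
      apply: measurable_sum => i.
      by apply: measurable_funM; [exact: measurable_cst|exact: mz].
    have mpsi : measurable_fun [set: R] psi.
      apply: continuous_measurable_fun => x; apply: differentiable_continuous.
      by apply/derivable1_diffP; have := psiE x.
    apply/measurable_EFinP; apply: measurable_prod => t _.
    apply: measurableT_comp => //; apply: measurable_funB.
      by apply: measurable_funM; [exact: ma|exact: measurable_cst].
    apply: measurable_funB; last exact: measurable_cst.
    apply: (measurableT_comp mpsi).
    by apply: measurable_funD; [exact: measurable_cst|exact: ma].
  - by move=> w _; rewrite lee_fin.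
under eq_integral do rewrite EFinM -prodEFin.
rewrite ge0_integralZl_EFin ?expR_ge0//; last 2 first.
- by move=> w _; apply: prode_ge0.
- by apply: emeasurable_prod => i; exact: (measurableT_comp (mEG i) (mz i)).
rewrite lee_wpmul2l ?lee_fin ?expR_ge0//.
rewrite (z_iid (g := fun i x => (G i x)%:E))//.
apply: lee_prode => i; first by rewrite lee_fin divr_ge0 ?expR_ge0 ?sqrtr_ge0.
apply: gaussian_quadratic_lower_bound.
by rewrite divr_ge0// ltW.
Qed.

End evidence.

(** * The Gram matrix of the design, and the evidence outside the confidence set *)

Section design.
Context (R : realType) (d n : nat).

Lemma innerE (u v : 'rV[R]_d) : inner u v = (u *m v^T) 0 0.
Proof. by rewrite mxE; apply: eq_bigr => i _; rewrite mxE. Qed.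

Lemma design_gram_quad (x : 'I_n -> 'rV[R]_d) (v : 'rV[R]_d) :
  (v *m design_gram x *m v^T) 0 0 = \sum_(t < n) inner (x t) v ^+ 2.
Proof.
rewrite mulmx_sumr mulmx_suml summxE; apply: eq_bigr => t _.
rewrite [v *m (_ *m _)]mulmxA -mulmxA mxE big_ord1 -!innerE expr2.
by rewrite innerC.
Qed.

(** The quadratic form is a sum of squares; where it vanishes, [v] is annihilated by the Gram
    matrix, which full rank excludes for [v != 0]. *)
Lemma posdefmx_design_gram (x : 'I_n -> 'rV[R]_d) :
  \rank (design_gram x) = d -> posdefmx (design_gram x).
Proof.
move=> rk; split => [|v v0].
  rewrite /design_gram linear_sum/=; apply: eq_bigr => t _.
  by rewrite trmx_mul trmxK.
rewrite design_gram_quad lt_neqAle sumr_ge0 ?andbT => [|t _]; last exact: sqr_ge0.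
apply: contra v0; rewrite eq_sym psumr_eq0 => [/allP xv0|t _]; last exact: sqr_ge0.
have xv t : inner (x t) v = 0.
  by have /(_ (mem_index_enum t)) := xv0 t; rewrite /= sqrf_eq0 => /eqP.
have /row_freeP[B gB] : row_free (design_gram x) by rewrite -row_leq_rank rk.
rewrite -[v]mulmx1 -gB mulmxA (_ : v *m design_gram x = 0) ?mul0mx//.
rewrite mulmx_sumr big1// => t _; rewrite mulmxA.
by rewrite [v *m _]mx11_scalar -innerE innerC xv raddf0 mul0mx.
Qed.

Lemma gram_orthonormal (x : 'I_n -> 'rV[R]_d) (A : 'M[R]_d) :
  A^T *m design_gram x *m A = 1%:M ->
  forall i j, \sum_(t < n) (x t *m A) 0 i * (x t *m A) 0 j = (i == j)%:R.
Proof.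
move=> AE i j; have := congr1 (fun C : 'M[R]_d => C i j) AE.
rewrite mulmx_sumr mulmx_suml summxE mxE -mulr_natl mulr1 => <-.
apply: eq_bigr => t _.
rewrite (_ : _ *m A = (x t *m A)^T *m (x t *m A)).
  by rewrite [RHS]mxE big_ord1 [in RHS]mxE.
by rewrite trmx_mul !mulmxA.
Qed.

Context (disp : measure_display) (Z : measurableType disp)
  (Q : probability Z R) (z : 'I_d -> Z -> measurableTypeR R).
Hypotheses (mz : forall i, measurable_fun setT (z i))
  (z_iid : forall g : 'I_d -> measurableTypeR R -> \bar R,
    (forall i, measurable_fun setT (g i)) -> (forall i x, (0 <= g i x)%E) ->
    (\int[Q]_w \prod_(i < d) g i (z i w) =
     \prod_(i < d) \int[normal_prob 0 1]_x g i x)%E).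

(** The deterministic half of the argument, for fixed covariates and labels: leaving the confidence
    set forces large evidence. *)
Lemma evidence_gt (psi h : R -> R) (M m b delta : R) (x : 'I_n -> 'rV[R]_d)
    (y : 'I_n -> R) (A : 'M[R]_d) (theta c : 'rV[R]_d)
    (a := fun t w =>
       (Num.sqrt (m / 2))^-1 * \sum_(i < d) (x t *m A) 0 i * z i w) :
  smooth psi M -> 0 < m -> strongly_convex_on psi b m -> 0 < b -> 0 < delta ->
  A^T *m design_gram x *m A = 1%:M ->
  (forall t, `|inner theta (x t)| <= b) ->
  is_argmin (bounded_params b x)
    (fun theta => \sum_(t < n) glm_loss psi h (x t) (y t) theta) c ->
  ~ confidence_set psi (M / m) delta x c theta ->
  ((delta^-1)%:E <= \int[Q]_w (\prod_(t < n) expR (a t w * y t -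
     (psi (inner theta (x t) + a t w) - psi (inner theta (x t)))))%:E)%E.
Proof.
move=> psiM m0 psim b0 delta0 AE theta_b [cS cmin] out.
pose e t := inner theta (x t); pose s t := inner c (x t).
pose f1 := psi^`()%classic; pose f2 := (psi^`(2))%classic.
have psiE (u : R) : is_derive u 1 psi (f1 u).
  by rewrite /f1 derive1E; apply: derivableP; have [] := psiM u.
have f1E (u : R) : is_derive u 1 f1 (f2 u).
  by rewrite /f2 /derive1n /= derive1E; apply: derivableP; have [] := psiM u.
have f2M u : f2 u <= M by have [] := psiM u.
(* The two curvature bounds are compared at 0, which lies in [[- b, b]]; positivity of [M]
   follows. *)
have mM : m <= M.
  by apply: le_trans (f2M 0); apply: psim; rewrite in_itv/= oppr_le0 (ltW b0).
have M0 : 0 < M by exact: lt_le_trans mM.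
set B := \sum_(t < n) (psi (e t) - psi (s t) - f1 (s t) * (e t - s t)).
have BE : bregman (design_potential psi x) theta c = B.
  rewrite bregman_design_potential; last by move=> u; have [] := psiM u.
  by apply: eq_bigr => t _; rewrite !(innerC (x t)).
have opt : 0 <= \sum_(t < n) (f1 (s t) - y t) * (e t - s t).
  apply: (first_order_optimality psiE f1E f2M) => l /andP[l0 l1].
  have thE t : inner (c + l *: (theta - c)) (x t) = s t + l * (e t - s t).
    by rewrite innerC innerDr innerZr innerBr !(innerC (x t)).
  (* The constraint set is convex and contains both [c] and [theta], so [c] can be compared with the
     whole segment; the [ln h] terms of the losses cancel. *)
  have /cmin : bounded_params b x (c + l *: (theta - c)).
    move=> t; rewrite thE; have := theta_b t; have := cS t.
    by rewrite -/(e t) -/(s t) !ler_norml => /andP[? ?] /andP[? ?]; nra.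
  rewrite !sumrB lerD2r; under [leRHS]eq_bigr do rewrite thE.
  by [].
have Blb : m / 2 * \sum_(t < n) (s t - e t) ^+ 2 <= B.
  rewrite mulr_sumr; apply: ler_sum => t _.
  have psim' u : - b <= u <= b -> m <= f2 u.
    by move=> ub; apply: psim; rewrite in_itv.
  have := taylor2_lower psiE f1E psim'.
  move=> /(_ (s t) (e t)); rewrite -!ler_norml => /(_ (cS t) (theta_b t)).
  by rewrite -[(s t - e t) ^+ 2]sqrrN opprB; set p := psi (e t); lra.
have [_ Aunit] := mulmx1_unit AE.
(* Coordinates of [c - theta] in the basis given by the columns of [A], scaled by the square root of
   the prior precision [m / 2]. *)
pose dl i := Num.sqrt (m / 2) * (invmx A *m (c - theta)^T) i 0.
have m2 : 0 < m / 2 by rewrite divr_gt0.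
have sm2 : Num.sqrt (m / 2) != 0 by rewrite gt_eqF// sqrtr_gt0.
have orth := gram_orthonormal AE.
have se t : s t - e t =
    (Num.sqrt (m / 2))^-1 * \sum_(i < d) (x t *m A) 0 i * dl i.
  under eq_bigr do rewrite mulrCA.
  rewrite -mulr_sumr mulKf//.
  rewrite /s /e -!(innerC (x t)) -innerBr innerE.
  by rewrite -[in LHS](mulKVmx Aunit (c - theta)^T) [x t *m _ in LHS]mulmxA [LHS]mxE.
(* Together with [Blb] this bounds the Gaussian penalty [sum dl^2 / 2] by [B / 2], so half of the
   divergence survives in the exponent. *)
have dlE : \sum_(i < d) dl i ^+ 2 = m / 2 * \sum_(t < n) (s t - e t) ^+ 2.
  rewrite -(sum_sqr_orthonormal dl orth) mulr_sumr; apply: eq_bigr => t _.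
  by rewrite se exprMn exprVn sqr_sqrtr ?(ltW m2)// mulVKf// gt_eqF.
have := evidence_lower_bound mz z_iid m2 (ltW M0) psiE f1E f2M orth se opt.
apply: le_trans; rewrite -/B lee_fin.
move: out; rewrite /confidence_set/= BE => /negP; rewrite -ltNge => out.
rewrite big_split/= prodr_const card_ord.
rewrite (_ : M / (m / 2) = 2 * (M / m)); last by field; rewrite gt_eqF.
rewrite -(big_morph expR (@expRD R) (@expR0 R)) sumrN -mulr_suml dlE.
have k0 : 0 < 1 + 2 * (M / m) by rewrite addr_gt0// mulr_gt0// divr_gt0.
set q := Num.sqrt (1 + 2 * (M / m)).
have q0 : 0 < q by rewrite sqrtr_gt0.
have q2 : 1 + 2 * (M / m) = q ^+ 2 by rewrite sqr_sqrtr// ltW.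
rewrite mulrA -expRD exprVn ler_pdivlMr ?exprn_gt0//.
(* In logarithms the claim is half of the inequality that defines the complement of the confidence
   set, since [ln (1 + 2 M / m) = 2 ln q]. *)
rewrite -[leLHS]lnK ?posrE ?mulr_gt0 ?invr_gt0 ?exprn_gt0// ler_expR.
rewrite lnM ?posrE ?invr_gt0 ?exprn_gt0// lnXn//.
move: out; rewrite q2 div1r lnXn// -[ln q *+ 2]mulr_natl -[ln q *+ d]mulr_natl.
by lra.
Qed.

End design.

(** * The confidence set *)

Lemma markov_ge0 (R : realType) (disp : measure_display) (T : measurableType disp)
    (P : probability T R) (W : T -> \bar R) (delta : R) :
  0 < delta -> measurable_fun setT W -> (forall w, (0 <= W w)%E) ->
  (\int[P]_w W w <= 1)%E -> (P [set w | (delta^-1)%:E <= W w] <= delta%:E)%E.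
Proof.
move=> delta0 mW W0 EW.
have := le_integral_abse P measurableT mW (a := delta^-1).
rewrite invr_gt0 => /(_ delta0).
rewrite setTI (eq_integral W); last by move=> w _; rewrite gee0_abs.
move=> /le_trans/(_ EW); rewrite -lee_pdivlMl ?invr_gt0// invrK mule1.
by under eq_set do rewrite gee0_abs//.
Qed.

Lemma measurable_design_gram (R : realType) (d n : nat) (disp : measure_display)
    (T : measurableType disp) (X : 'I_n -> T -> 'rV[R]_d) :
  (forall t i, measurable_fun [set: T] (fun w => X t w 0 i)) ->
  measurable_mx (fun w => design_gram (X ^~ w)).
Proof.
move=> mX; apply: measurable_mx_sum => t; apply: measurable_mx_mul.
  by apply: measurable_mx_tr => i j; rewrite (ord1 i); exact: mX.
by move=> i j; rewrite (ord1 i); exact: mX.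
Qed.

(** The possibly nonmeasurable [E] is covered by [F] and a measurable null set. *)
Lemma mu_ext_le_ae (R : realType) (disp : measure_display) (T : measurableType disp)
    (P : probability T R) (E F : set T) (r : \bar R) :
  measurable F -> (P F <= r)%E -> {ae P, forall w, E w -> F w} ->
  (mu_ext P E <= r)%E.
Proof.
move=> mF PF [N [mN PN0 EFN]].
apply: (@le_trans _ _ (mu_ext P (F `|` N))).
  apply: le_mu_ext => w Ew; have [Fw|nFw] := pselect (F w); [by left|right].
  by apply: EFN => /= /(_ Ew).
rewrite measurable_mu_extE; last exact: measurableU.
apply: le_trans (measureU2 _ mF mN) _.
by rewrite [X in (_ + X)%E]PN0 adde0.
Qed.

(* Both the standing assumptions on the covariates and the minimality of
   [theta_hat] are required almost surely. [theta_hat] is not assumed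
   measurable, so the conclusion is stated with the outer measure [mu_ext P],
   which equals [P] on measurable sets ([measurable_mu_extE]). *)
Theorem theorem4p3 (R : realType) (d n : nat) (disp : measure_display)
  (T : measurableType disp) (P : probability T R)
  (nu : {sigma_finite_measure set (measurableTypeR R) -> \bar R})
  (D : set (measurableTypeR R)) (psi h : R -> R) (theta_star : 'rV[R]_d)
  (X : 'I_n -> T -> 'rV[R]_d) (Y : 'I_n -> {RV P >-> measurableTypeR R})
  (theta_hat : T -> 'rV[R]_d) (b M m delta : R)
  (d_ge1 : (1 <= d)%N) (n_ge1 : (1 <= n)%N)
  (mD : measurable D)
  (h_ge0 : forall y, D y -> 0 <= h y)
  (psi_convex : @convex_function R R^o setT psi)
  (psi_derivable : forall z, derivable psi z 1)
  (p_density : forall x theta : 'rV[R]_d,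
     is_prob_density nu D (glm_density psi h x theta))
  (X_measurable : forall t, random_vector (X t))
  (XY_model : glm_model P nu D psi h theta_star X Y)
  (X_full_rank : {ae P, forall w, \rank (design_gram (X ^~ w)) = d})
  (b_gt0 : 0 < b)
  (theta_star_bounded :
     {ae P, forall w, forall t, `|inner theta_star (X t w)| <= b})
  (psi_smooth : smooth psi M)
  (m_gt0 : 0 < m)
  (psi_strongly_convex : strongly_convex_on psi b m)
  (theta_hat_argmin : {ae P, forall w,
     is_argmin (bounded_params b (X ^~ w))
       (fun theta => \sum_(t < n) glm_loss psi h (X t w) (Y t w) theta)
       (theta_hat w)})
  (delta_gt0 : 0 < delta) :
  (mu_ext P [set w | ~ confidence_set psi (M / m) delta (X ^~ w)
                         (theta_hat w) theta_star] <= delta%:E)%E.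
Proof.
pose G : set (set T) := [set E | exists (t : 'I_n) (i : 'I_d),
        exists2 B : set (measurableTypeR R),
          measurable B & E = [set w | B (X t w 0 i)]].
have Gm : <<s G>> `<=` @measurable disp T.
  apply: smallest_sub => [|E [t [i [B mB ->]]]].
    exact: sigma_algebra_measurable.
  by have := X_measurable t i measurableT B mB; rewrite setTI.
have mX t i : measurable_fun [set: g_sigma_algebraType G] (fun w => X t w 0 i).
  move=> _ B mB; rewrite setTI; apply: sub_sigma_algebra.
  by exists t, i, B.
have psi_cont : continuous psi.
  move=> u; apply: differentiable_continuous.
  by apply/derivable1_diffP; exact: psi_derivable.
have mpsi : measurable_fun [set: R] psi by exact: continuous_measurable_fun.
have glm0 y : glm_density psi h (0 : 'rV[R]_d) 0 y = expR (- psi 0) * h y :> R.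
  rewrite /glm_density (_ : inner (0 : 'rV[R]_d) 0 = 0) ?mul0r ?sub0r//.
  by rewrite /inner big1// => i _; rewrite mxE mul0r.
(* Cutting [h] to zero off [D] turns integrals over the label set into integrals over the line. *)
pose hD : measurableTypeR R -> R := h \_ D.
have mhD : measurable_fun setT hD.
  apply: (measurable_restrictT h mD).1.
  have [mp _ _] := p_density 0 0.
  (* Measurability of [h] is read off the density at linear predictor zero, which is a positive
     multiple of [h]. *)
  have -> : h = (fun y => expR (psi 0) * glm_density psi h (0 : 'rV[R]_d) 0 y).
    by apply/funext => y; rewrite glm0 mulrA -expRD subrr expR0 mul1r.
  exact: measurable_funM.
have hD0 y : 0 <= hD y.
  by rewrite /hD patchE; case: ifPn => // /[!inE]; exact: h_ge0.
have normalized (r : R) : (\int[nu]_y (expR (r * y - psi r) * hD y)%:E = 1)%E.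
  (* As [d >= 1], every real [r] is a linear predictor: take the first basis vector as covariate and
     [r] times it as parameter. *)
  pose x : 'rV[R]_d := delta_mx 0 (Ordinal d_ge1).
  have [_ _ <-] := p_density x (r *: x).
  rewrite [RHS]integral_mkcond; apply: eq_integral => y _.
  rewrite patchE /hD patchE; case: ifPn => _; last by rewrite mulr0.
  rewrite /glm_density (_ : inner (r *: x) x = r)//.
  rewrite innerC innerZr /inner (bigD1 (Ordinal d_ge1))//= big1 => [|j ji].
    by rewrite addr0 mxE !eqxx !mulr1.
  by rewrite mxE (negPf ji) andbF mul0r.
pose e t (w : g_sigma_algebraType G) := inner theta_star (X t w).
have me t : measurable_fun setT (e t).
  by apply: measurable_sum => i; apply: measurable_funM => //; exact: measurable_cst.
have law (E : set T) (B : 'I_n -> set (measurableTypeR R)) :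
    <<s G>> E -> (forall t, measurable (B t)) ->
    (P (E `&` [set w | forall t, B t (Y t w)]) =
    \int[P]_(w in E) \prod_(t < n) \int[nu]_y ((\1_(B t) y)%:E *
       (expR (e t w * y - psi (e t w)) * hD y)%:E))%E.
  move=> GE mB; rewrite (XY_model _ _ GE mB); apply: eq_integral => w _.
  apply: eq_bigr => t _; rewrite integral_mkcond; apply: eq_integral => y _.
  rewrite patchE /hD patchE indicE in_setI.
  by case: (y \in D); case: (y \in B t) => /=; rewrite ?mul1e ?mul0e ?mulr0 ?mule0.
have [chol [mchol cholE]] := measurable_inverse_cholesky R d.
have [dispZ [Z [Q [z [mz z_iid]]]]] :=
  iid_sample_space (normal_prob (0 : R) (1 : R)) d.
(* The shift of the predictors caused by the prior draw [zeta]. For fixed [zeta] it depends on the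
   covariates only, as the mean bound for likelihood ratios requires. *)
pose a (zeta : Z) (t : 'I_n) (w : T) : R := (Num.sqrt (m / 2))^-1 *
  \sum_(i < d) (X t w *m chol (design_gram (X ^~ w))) 0 i * z i zeta.
have mXA (dT : measure_display) (T' : measurableType dT)
    (U : 'I_n -> T' -> 'rV[R]_d) t i :
    (forall s j, measurable_fun [set: T'] (fun w => U s w 0 j)) ->
    measurable_fun [set: T']
      (fun w => (U t w *m chol (design_gram (U ^~ w))) 0 i).
  move=> mU; apply: measurable_mx_mul.
    by move=> k j; rewrite (ord1 k); exact: mU.
  by apply: mchol; exact: measurable_design_gram.
have ma zeta t : measurable_fun [set: g_sigma_algebraType G] (a zeta t).
  apply: measurable_funM; first exact: measurable_cst.
  apply: measurable_sum => i; apply: measurable_funM; last exact: measurable_cst.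
  exact: mXA.
pose L (v : T * Z) : R := likelihood_ratio Y psi e (a v.2) v.1.
have mL : measurable_fun setT L.
  have mXT t i : measurable_fun [set: T] (fun w => X t w 0 i) by exact: X_measurable.
  have ma2 t : measurable_fun [set: T * Z] (fun v => a v.2 t v.1).
    apply: measurable_funM; first exact: measurable_cst.
    apply: measurable_sum => i; apply: measurable_funM.
      exact: (measurableT_comp (mXA _ _ X t i mXT) measurable_fst).
    exact: (measurableT_comp (mz i) measurable_snd).
  have mY2 t : measurable_fun [set: T * Z] (fun v => Y t v.1 : R).
    exact: (measurableT_comp (measurable_funP (Y t)) measurable_fst).
  have me2 t : measurable_fun [set: T * Z] (fun v => e t v.1).
    exact: (measurableT_comp (measurable_fun_sub_sigma Gm (me t)) measurable_fst).
  apply: measurable_prod => t _; apply: measurableT_comp => //.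
  apply: measurable_funB; first exact: measurable_funM.
  apply: measurable_funB; last exact: (measurableT_comp mpsi).
  by apply: (measurableT_comp mpsi); exact: measurable_funD.
have mEL : measurable_fun setT (fun v => (L v)%:E) by exact/measurable_EFinP.
have L0 v : (0 <= (L v)%:E)%E by rewrite lee_fin likelihood_ratio_ge0.
pose W (w : T) : \bar R := (\int[Q]_zeta (L (w, zeta))%:E)%E.
have mW : measurable_fun setT W.
  exact: (@measurable_fun_fubini_tonelli_F _ _ _ _ _ Q (fun v => (L v)%:E) mEL L0).
have W0 w : (0 <= W w)%E by apply: integral_ge0.
have EW : (\int[P]_w W w <= 1)%E.
  (* After exchanging the integrals, the mean bound applies to each prior draw separately. *)
  rewrite /W (@fubini_tonelli _ _ _ _ _ P Q (fun v => (L v)%:E) mEL L0).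
  apply: (@le_trans _ _ (\int[Q]_zeta 1)%E); last first.
    by rewrite integral_cst// mul1e probability_le1.
  apply: ge0_le_integral => //.
  - by move=> zeta _; apply: integral_ge0.
  - exact: (@measurable_fun_fubini_tonelli_G _ _ _ _ _ P (fun v => (L v)%:E) mEL L0).
  move=> zeta _; apply: (integral_likelihood_ratio_le1 Gm _ me psi_cont mhD hD0
    normalized law (ma zeta)).
  by move=> t; exact: measurable_funP.
apply: (mu_ext_le_ae (F := [set w | (delta^-1)%:E <= W w])%E).
- rewrite -[X in measurable X]setTI; exact: emeasurable_fun_c_infty.
- exact: markov_ge0.
apply: filterS3 X_full_rank theta_star_bounded theta_hat_argmin => w rk bnd argm out.
have AE := cholE _ (posdefmx_design_gram rk).
exact: (@evidence_gt _ _ _ _ _ Q z mz z_iid psi h M m b delta (X ^~ w)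
  (fun t => Y t w) _ theta_star (theta_hat w) psi_smooth m_gt0
  psi_strongly_convex b_gt0 delta_gt0 AE bnd argm out).
Qed.
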